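(* Let $\mathbb Z^{(mix)}[h_r\mid r>0]$ be the $\mathbb Z$-subalgebra of $\mathbb Q[h_r\mid r>0]$ generated by $\{\hat h_k,\bar h_k\mid k>0\}$. For $k:\mathbb Z_{>0}\to\mathbb N$ finitely supported let $$b_k'=\prod_{m>0,\ m\text{ odd}}\lambda_m(\hat h_{k_m})\prod_{m>0,\ m\text{ even}}\lambda_m(\check h_{k_m}),$$ let $B_\lambda'=\{b_k'\mid k:\mathbb Z_{>0}\to\mathbb N\text{ finitely supported}\}$ and let $\mathbb Z_\lambda'[h_r\mid r>0]$ be the $\mathbb Z$-linear span of $B_\lambda'$. Then $\mathbb Z^{(mix)}[h_r\mid r>0]=\mathbb Z'_\lambda[h_r\mid r>0]$, this is an integral form of $\mathbb Q[h_r\mid r>0]$, and $B'_\lambda$ is a $\mathbb Z$-basis of $\mathbb Z^{(mix)}[h_r\mid r>0]$.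
   Context: $\mathbb Q[h_r\mid r\in\mathbb Z_{>0}]$ is the polynomial algebra in the variables $h_r$. For $m>0$, $\lambda_m$ is the $\mathbb Q$-algebra endomorphism with $\lambda_m(h_r)=h_{mr}$ for all $r$. For $a:\mathbb Z_{>0}\to\mathbb Q$ define $\hat h_k^{\{a\}}$ by $\sum_{k\ge0}\hat h_k^{\{a\}}u^k=\exp\left(\sum_{r>0}(-1)^{r-1}\frac{a_rh_r}{r}u^r\right)$. Then $\hat h_k=\hat h_k^{\{a\}}$ for $a_r=1$ for all $r$; $\check h_k=\hat h_k^{\{a\}}$ for $a_r=\frac12$ for all $r$; $\bar h_k=\hat h_k^{\{a\}}$ for $a_r=1$ if $r$ is even and $a_r=0$ if $r$ is odd. A $\mathbb Z$-subalgebra $U_{\mathbb Z}$ of a $\mathbb Q$-algebra $U$ is an integral form of $U$ if it is a free $\mathbb Z$-module and $\mathbb Q\otimes_{\mathbb Z}U_{\mathbb Z}\to U$ is an isomorphism. *)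

(* Defs.v *)
From HB Require Import structures.
From mathcomp Require Import all_boot all_order all_algebra.
From mathcomp Require Import finmap.
From mathcomp.multinomials Require Export monalg.

Set Implicit Arguments.
Unset Strict Implicit.
Unset Printing Implicit Defensive.

Import GRing.Theory.
Local Open Scope ring_scope.

Record posint := PosInt { posint_val :> nat; posint_gt0 : (0 < posint_val)%N }.
HB.instance Definition _ := [isSub for posint_val].
HB.instance Definition _ := [Choice of posint by <:].

Fact posint_mul_gt0 (m r : posint) : (0 < m * r)%N.
Proof. by rewrite muln_gt0 !posint_gt0. Qed.
Definition posint_mul (m r : posint) : posint := PosInt (posint_mul_gt0 m r).

Section IntegralForms.
Variable U : algType rat.
Implicit Types (S B V : U -> Prop) (x y : U).

Definition is_subring V : Prop :=
  [/\ V 1, forall x y, V x -> V y -> V (x - y)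
    & forall x y, V x -> V y -> V (x * y)].

Inductive subring_gen S : U -> Prop :=
| subring_gen_in x : S x -> subring_gen S x
| subring_gen1 : subring_gen S 1
| subring_genB x y : subring_gen S x -> subring_gen S y -> subring_gen S (x - y)
| subring_genM x y : subring_gen S x -> subring_gen S y -> subring_gen S (x * y).

Definition Zspan B x : Prop :=
  exists (s : seq U) (c : U -> int),
    (forall b, b \in s -> B b) /\ x = \sum_(b <- s) b *~ c b.

Definition Zfree B : Prop :=
  forall (s : seq U) (c : U -> int), uniq s -> (forall b, b \in s -> B b) ->
  \sum_(b <- s) b *~ c b = 0 -> forall b, b \in s -> c b = 0.

Definition is_Zbasis B V : Prop := (forall x, V x <-> Zspan B x) /\ Zfree B.

(* Q (x)_Z V is the free abelian group on rat * V modulo the subgroup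
   [tensor_rel V].  Its elements are represented by the formal sums
   g : {malg int[rat * U]} all of whose generators have second component in V. *)
Definition tensor_repr V (g : {malg int[(rat * U)%type]}) : Prop :=
  forall p, p \in msupp g -> V p.2.

Inductive tensor_rel V : {malg int[(rat * U)%type]} -> Prop :=
| tensor_relDl p q x : V x ->
    tensor_rel V (<< (p + q, x) >> - << (p, x) >> - << (q, x) >>)
| tensor_relDr p x y : V x -> V y ->
    tensor_rel V (<< (p, x + y) >> - << (p, x) >> - << (p, y) >>)
| tensor_relZ p (n : int) x : V x ->
    tensor_rel V (<< (p *~ n, x) >> - << (p, x *~ n) >>)
| tensor_rel0 : tensor_rel V 0
| tensor_relB g g' : tensor_rel V g -> tensor_rel V g' -> tensor_rel V (g - g').

(* The map induced by p (x) x |-> p *: x. *)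
Definition tensor_eval (g : {malg int[(rat * U)%type]}) : U :=
  \sum_(p <- msupp g) (p.1 *: p.2) *~ g@_p.

Fact tensor_evalEw (d : {fset (rat * U)%type}) (g : {malg int[(rat * U)%type]}) :
  (msupp g `<=` d)%fset -> tensor_eval g = \sum_(p <- d) (p.1 *: p.2) *~ g@_p.
Proof.
move=> le; rewrite [LHS](big_fset_incl _ le) => //= x xd /mcoeff_outdom ->.
by rewrite mulr0z.
Qed.

Fact tensor_evalB : {morph tensor_eval : g g' / g - g'}.
Proof.
move=> g g';
rewrite (tensor_evalEw (msuppB_le g g')) (tensor_evalEw (fsubsetUl _ (msupp g'))).
rewrite (tensor_evalEw (fsubsetUr (msupp g) _)) -sumrB.
by apply: eq_bigr => p _; rewrite mcoeffB mulrzBr.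
Qed.

Fact tensor_evalU p : tensor_eval << p >> = p.1 *: p.2.
Proof. by rewrite (tensor_evalEw msuppU_le) big_seq_fset1 mcoeffUU mulr1z. Qed.

Fact tensor_rel_eval V g : tensor_rel V g -> tensor_eval g = 0.
Proof.
elim=> [p q x _|p x y _ _|p n x _||g1 g2 _ e1 _ e2];
  rewrite ?tensor_evalB ?tensor_evalU ?e1 ?e2 ?subr0 //=.
- by rewrite scalerDl addrAC addrK subrr.
- by rewrite scalerDr addrAC addrK subrr.
- by rewrite -scalerMzl scalerMzr subrr.
- by rewrite /tensor_eval msupp0 big_seq_fset0.
Qed.

Definition tensor_eval_bijective V : Prop :=
  (forall g, tensor_repr V g -> tensor_eval g = 0 -> tensor_rel V g) /\
  (forall x, exists2 g, tensor_repr V g & tensor_eval g = x).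

Definition is_integral_form V : Prop :=
  [/\ is_subring V, (exists B, is_Zbasis B V) & tensor_eval_bijective V].

End IntegralForms.

Notation Qh := {malg rat[{cmonom posint}]}.

Definition h (r : posint) : Qh := << ucm r >>.

Section Lambda.
Variable m : posint.

Definition lambda_monom (k : {cmonom posint}) : Qh :=
  \prod_(r <- finsupp k) h (posint_mul m r) ^+ k r.

Fact lambda_monom_morphism : mmorphism lambda_monom.
Proof.
have E (d : {fset posint}) (k : {cmonom posint}) : (finsupp k `<=` d)%fset ->
    lambda_monom k = \prod_(r <- d) h (posint_mul m r) ^+ k r.
  move=> sub; rewrite /lambda_monom (big_fset_incl _ sub) // => r _.
  by rewrite -cmE_eq0 => /eqP ->; rewrite expr0.
split=> [k k'|]; last by rewrite /lambda_monom mdom1 big_seq_fset0.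
rewrite (E _ _ (fsubset_refl _)) mdomD (E _ k (fsubsetUl _ (finsupp k'))).
rewrite (E _ k' (fsubsetUr (finsupp k) _)) -big_split /=.
by apply: eq_bigr => r _; rewrite cmM exprD.
Qed.
HB.instance Definition _ :=
  isMultiplicative.Build _ _ lambda_monom lambda_monom_morphism.

Definition lambda : Qh -> Qh := mmap (@malgC {cmonom posint} rat) lambda_monom.

HB.instance Definition _ := GRing.RMorphism.on lambda.

Fact lambda_is_scalable : scalable lambda.
Proof. by move=> c g; rewrite /lambda mmapZ mul_malgC. Qed.
HB.instance Definition _ :=
  GRing.isScalable.Build rat Qh Qh *:%R lambda lambda_is_scalable.

Fact lambda_h r : lambda (h r) = h (posint_mul m r).
Proof.
rewrite /lambda mmapU mul1r /= /lambda_monom mdomU big_seq_fset1 cmUU expr1.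
by [].
Qed.

End Lambda.

(* For a formal power series f = \sum_k f k u^k with f 0 = 0, the coefficient of
   u^k in exp f = \sum_n f^n / n!.  Only n <= k contribute, and the coefficient
   of u^k in f^n only depends on the truncation of f at degree k. *)
Definition fps_exp (U : algType rat) (f : nat -> U) (k : nat) : U :=
  \sum_(n < k.+1) (n`!%:R : rat)^-1 *: ((\poly_(i < k.+1) f i) ^+ n)`_k.

Definition log_series (a : posint -> rat) (n : nat) : Qh :=
  if insub n is Some r then ((-1) ^+ n.-1 * a r / n%:R) *: h r else 0.

Definition hgen (a : posint -> rat) : nat -> Qh := fps_exp (log_series a).

Definition hath : nat -> Qh := hgen (fun=> 1).
Definition checkh : nat -> Qh := hgen (fun=> 1 / 2).
Definition barh : nat -> Qh := hgen (fun r => if odd r then 0 else 1).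

Definition mix_gen (x : Qh) : Prop :=
  exists2 k : nat, (0 < k)%N & x = hath k \/ x = barh k.

Definition Zmix : Qh -> Prop := subring_gen mix_gen.

(* The factors with k m = 0 are 1, so the product ranges over the support. *)
Definition b' (k : {fsfun posint -> nat with 0%N}) : Qh :=
  (\prod_(m <- finsupp k | odd m) lambda m (hath (k m))) *
  (\prod_(m <- finsupp k | ~~ odd m) lambda m (checkh (k m))).

Definition B'lambda (x : Qh) : Prop := exists k, x = b' k.

Definition Z'lambda : Qh -> Prop := Zspan B'lambda.

(* Main.v *)
(* Read h_r as the r-th power sum of variables x_1, x_2, ...: then the hat h_k are
   the elementary symmetric functions and lambda_m replaces each x_i by x_i^m.
   Call f integral when all the coefficients of the symmetric function f are
   integers; they are reached by splitting off variables one at a time through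
   h_r |-> h_r + y^r and finally taking constant terms.  The integral elements form
   a ring, which contains every lambda_m (hat h_k).  Moreover:
   - prod_m lambda_m (hat h_(k_m)) is h^k / prod_m k_m! plus terms of lower degree,
     and integrality of f makes (prod_m k_m!) times its top coefficients integers,
     so the integral elements are Z-combinations of these products;
   - the top y-coefficient of the monomial prod_r (hat h_r)^(k_r) is the monomial
     prod_r (hat h_(r-1))^(k_r), so the integral elements are also the integral
     polynomials in the hat h_k.
   Since barh_(2k) = +- lambda_2 (check h_k), the ring Z^mix is generated by the
   ring of integral elements and by its image E under h_r |-> h_(2r) / 2.  As
   hat h = check h * check h, E contains lambda_m (hat h_k) for m even, so these
   factors of the first basis can be traded for the basis of E, which is made of
   the products of the lambda_m (check h_(k_m)), m even.  Freeness is read off the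
   leading terms. *)

From HB Require Import structures.
Require Import Defs.
From mathcomp Require Import all_boot all_order all_algebra finmap.
From mathcomp Require Import zify.
From mathcomp.multinomials Require Import monalg.

Set Implicit Arguments.
Unset Strict Implicit.
Unset Printing Implicit Defensive.

Import Order.TTheory GRing.Theory Num.Theory.
Local Open Scope ring_scope.

(** * Exponentials of power series *)

Lemma coef_exp_trunc (R : comNzRingType) (p q : {poly R}) n j :
  (forall i, (i <= j)%N -> p`_i = q`_i) -> (p ^+ n)`_j = (q ^+ n)`_j.
Proof.
elim: n j => [|n IHn] j pq; first by rewrite !expr0.
rewrite !exprS !coefM; apply: eq_bigr => -[i /= lti] _; congr (_ * _).
  exact: pq.
by apply: IHn => l lel; apply: pq; apply: leq_trans lel (leq_subr _ _).
Qed.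

Lemma coef_exp_lt (R : comNzRingType) (p : {poly R}) n j :
  p`_0 = 0 -> (j < n)%N -> (p ^+ n)`_j = 0.
Proof.
move=> p0; elim: n j => // n IHn j ltj.
rewrite exprS coefM big1 // => -[[|i] /= lti] _; first by rewrite p0 mul0r.
rewrite IHn ?mulr0 //; move: lti ltj; case: j => // j lti ltj.
by rewrite subSS; apply: leq_ltn_trans (leq_subr _ _) _.
Qed.

(* u E' = (sum_i (p i) u^(i+1)) E with E(0) = 1, that is,
   E = exp (sum_i (p i) u^(i+1) / (i+1)). *)
Definition newton (R : nzRingType) (p E : nat -> R) :=
  E 0%N = 1 /\ forall n, E n.+1 *+ n.+1 = \sum_(i < n.+1) p i * E (n - i)%N.

Definition torsion_free (R : zmodType) :=
  forall (x : R) n, x *+ n.+1 = 0 -> x = 0.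

(** The recursion gives (n+1) E(n+1) from the earlier coefficients, and torsion-freeness cancels
    n+1. The identities between series below follow by checking that both sides satisfy one
    recursion. *)
Lemma newton_uniq (R : nzRingType) (p E F : nat -> R) : torsion_free R ->
  newton p E -> newton p F -> E =1 F.
Proof.
move=> tf [E0 ES] [F0 FS]; elim/ltn_ind=> -[|n] IHn; first by rewrite E0 F0.
apply/eqP; rewrite -subr_eq0; apply/eqP/(tf _ n).
rewrite mulrnBl ES FS -sumrB big1 // => i _.
by rewrite IHn ?subrr // ltnS leq_subr.
Qed.

Lemma newton_morph (R S : nzRingType) (f : {rmorphism R -> S}) p E :
  newton p E -> newton (f \o p) (f \o E).
Proof.
move=> [E0 ES]; split=> [|n] /=; first by rewrite E0 rmorph1.
rewrite -rmorphMn ES rmorph_sum; apply: eq_bigr => i _; exact: rmorphM.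
Qed.

Lemma newton_ext (R : nzRingType) (p q E F : nat -> R) :
  p =1 q -> E =1 F -> newton p E -> newton q F.
Proof.
move=> pq EF [E0 ES]; split=> [|n]; first by rewrite -EF.
by rewrite -EF ES; apply: eq_bigr => i _; rewrite pq EF.
Qed.

(** Logarithmic derivatives add under products: this is the Leibniz rule for E F, read at degree
    n. *)
Lemma newton_conv (R : comNzRingType) (p q E F : nat -> R) :
  newton p E -> newton q F ->
  newton (fun i => p i + q i) (fun n => \sum_(i < n.+1) E i * F (n - i)%N).
Proof.
move=> [E0 ES] [F0 FS].
split=> [|n]; first by rewrite big_ord1 E0 F0 mul1r.
(* Truncation to degree n+1 keeps all the coefficients involved and makes polynomial derivatives
   available. *)
pose P (s : nat -> R) := \poly_(i < n.+2) s i.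
have coefP s j : (j <= n.+1)%N -> (P s)`_j = s j.
  by move=> lej; rewrite coef_poly ltnS lej.
have conv s t j : (j <= n.+1)%N ->
    (P s * P t)`_j = \sum_(i < j.+1) s i * t (j - i)%N.
  move=> lej; rewrite coefM; apply: eq_bigr => -[i /= lti] _.
  by rewrite !coefP //; [apply: leq_trans (leq_subr _ _) lej|apply: leq_trans lej].
have der (s t : nat -> R) :
    (forall n, t n.+1 *+ n.+1 = \sum_(i < n.+1) s i * t (n - i)%N) ->
    forall j, (j <= n)%N -> (P t)^`()`_j = (P s * P t)`_j.
  by move=> H j lej; rewrite coef_deriv coefP // H conv // ltnW.
have mulC (u v w : {poly R}) : (forall j, (j <= n)%N -> u`_j = v`_j) ->
    (u * w)`_n = (v * w)`_n.
  move=> uv; rewrite !coefM; apply: eq_bigr => -[i /= lti] _.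
  by rewrite uv.
rewrite -conv // -coef_deriv derivM coefD (mulC _ (P p * P E) _ (der p E ES)).
rewrite [P E * _]mulrC (mulC _ (P q * P F) _ (der q F FS)).
have -> : P p * P E * P F = P p * (P E * P F) by rewrite mulrA.
have -> : P q * P F * P E = P q * (P E * P F) by rewrite [P E * _]mulrC mulrA.
rewrite -coefD -mulrDl coefM; apply: eq_bigr => -[i /= lti] _.
rewrite conv; last by apply: leq_trans (leq_subr _ _) _.
by rewrite coefD !coefP // ltnW.
Qed.

(* E(u) (1 + y u). *)
Lemma newton_mul1 (R : comNzRingType) (y : R) (p E : nat -> R) :
  newton p E ->
  newton (fun i => p i + (-1) ^+ i * y ^+ i.+1)
         (fun n => E n + (if n is n'.+1 then y * E n' else 0)).
Proof.
move=> [E0 ES]; split=> [|n]; first by rewrite E0 addr0.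
under eq_bigr do rewrite mulrDl; rewrite big_split /=.
under eq_bigr do rewrite mulrDr; rewrite big_split /= -ES.
rewrite mulrnDl -addrA; congr (_ + _).
have -> : \sum_(i < n.+1) p i * (if (n - i)%N is n'.+1 then y * E n' else 0)
   = y * E n *+ n.
  rewrite big_ord_recr /= subnn mulr0 addr0.
  case: n => [|n]; first by rewrite big_ord0.
  rewrite -mulrnAr ES mulr_sumr; apply: eq_bigr => -[i /= lti] _.
  by rewrite subSn // mulrCA.
rewrite mulrSr; congr (_ + _).
(* The series sum_i (-1)^i y^(i+1) u^i is y / (1 + y u), so its product with (1 + y u) G(u) is y
   G(u). *)
suff tel m (G : nat -> R) : \sum_(i < m.+1) (-1) ^+ i * y ^+ i.+1 *
   (G (m - i)%N + (if (m - i)%N is n'.+1 then y * G n' else 0)) = y * G m.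
  by rewrite (tel n E).
elim: m => [|m IHm]; first by rewrite big_ord1 subnn /= addr0 expr0 mul1r expr1.
rewrite big_ord_recl subn0 expr0 mul1r expr1 mulrDr -addrA.
rewrite -[RHS]addr0; congr (_ + _).
rewrite -{1}IHm mulr_sumr -big_split big1 //= => -[i /= lti] _.
rewrite /bump /= add1n subSS [(-1) ^+ _.+1]exprS [y ^+ i.+2]exprS.
by rewrite mulN1r mulNr mulNr [(-1) ^+ i * (y * _)]mulrCA -!mulrA subrr.
Qed.

(** A truncation bound K independent of k lets all the coefficients of degree below K be read off
    one polynomial. *)
Lemma fps_expE (U : comAlgType rat) (f : nat -> U) K k :
  f 0%N = 0 -> (k < K)%N ->
  fps_exp f k =
  \sum_(n < K) (n`!%:R : rat)^-1 *: ((\poly_(i < K) f i) ^+ n)`_k.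
Proof.
move=> f0 ltk; rewrite /fps_exp.
rewrite (big_ord_widen_cond _ xpredT
  (fun n => (n`!%:R : rat)^-1 *: ((\poly_(i < k.+1) f i) ^+ n)`_k) ltk).
rewrite [RHS](bigID (fun n : 'I_K => (n < k.+1)%N)) /=.
rewrite [X in _ = _ + X]big1 ?addr0.
  apply: eq_big => [i|i lti]; first by [].
  congr (_ *: _); apply: coef_exp_trunc => j lej.
  by rewrite !coef_poly ltnS lej (leq_ltn_trans lej ltk).
move=> i; rewrite -leqNgt => lti.
by rewrite coef_exp_lt ?scaler0 // coef_poly f0 if_same.
Qed.

(** Termwise, the derivative of f^(l+1) / (l+1)! is f' f^l / l!. *)
Lemma newton_fps_exp (U : comAlgType rat) (f : nat -> U) : f 0%N = 0 ->
  newton (fun i => f i.+1 *+ i.+1) (fps_exp f).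
Proof.
move=> f0; split=> [|n].
  by rewrite /fps_exp big_ord1 expr0 coef1 fact0 invr1 scale1r.
pose p := \poly_(i < n.+2) f i.
have EE k : (k < n.+2)%N ->
    fps_exp f k = (\sum_(l < n.+2) (l`!%:R : rat)^-1 *: (p ^+ l)`_k).
  exact: fps_expE.
have pE i : (i <= n)%N -> p^`()`_i = f i.+1 *+ i.+1.
  by move=> lei; rewrite coef_deriv coef_poly !ltnS lei.
rewrite EE // big_ord_recl expr0 coef1 scaler0 add0r.
have -> : \sum_(i < n.+1) f i.+1 *+ i.+1 * fps_exp f (n - i) =
   \sum_(i < n.+1) \sum_(l < n.+1) (l`!%:R : rat)^-1 *: (p^`()`_i * (p ^+ l)`_(n - i)).
  apply: eq_bigr => -[i /= lti] _; rewrite EE; last first.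
    by rewrite ltnS; apply: leq_trans (leq_subr _ _) _.
  (* The term l = n+1 vanishes: p has no constant term and the degree n - i is at most n. *)
  rewrite big_ord_recr coef_exp_lt /=.
  - by rewrite scaler0 addr0 pE // mulr_sumr; apply: eq_bigr => l _; rewrite -scalerAr.
  - by rewrite coef_poly.
  - by rewrite ltnS leq_subr.
rewrite exchange_big -sumrMnl; apply: eq_bigr => -[l /= ltl] _.
rewrite -scaler_sumr -coefM scalerMnr -coef_deriv deriv_exp.
rewrite /bump /= add1n coefMn factS natrM invfM mulrC -scalerA.
by rewrite -scaler_nat [_ *: (_%:R *: _)]scalerA mulVf ?scale1r // pnatr_eq0.
Qed.

(** * Integral spans and tensor products *)

Section ZmodClosed.
Variables (G : zmodType) (R : G -> Prop).
Hypotheses (R0 : R 0) (RB : forall g g', R g -> R g' -> R (g - g')).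

Lemma closedN g : R g -> R (- g).
Proof. by move=> Rg; rewrite -sub0r; apply: RB. Qed.

Lemma closedD g g' : R g -> R g' -> R (g + g').
Proof. by move=> Rg Rg'; rewrite -[g']opprK; apply/RB/closedN. Qed.

Lemma closedMz g n : R g -> R (g *~ n).
Proof.
have Mn m : R g -> R (g *+ m).
  by move=> Rg; elim: m => [|m IHm]; rewrite ?mulr0n // mulrS; apply: closedD.
move=> Rg; case: n => n; first exact: Mn.
by rewrite NegzE mulrNz; apply/closedN/Mn.
Qed.

Lemma cong_sym a b : R (a - b) -> R (b - a).
Proof. by move/closedN; rewrite opprB. Qed.

Lemma cong_trans b a c : R (a - b) -> R (b - c) -> R (a - c).
Proof. by move=> ab bc; rewrite -(subrK b a) -addrA; apply: closedD. Qed.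

Lemma congD a b c d : R (a - b) -> R (c - d) -> R ((a + c) - (b + d)).
Proof. by rewrite opprD addrACA; apply: closedD. Qed.

Lemma congMz n a b : R (a - b) -> R (a *~ n - b *~ n).
Proof. by rewrite -mulrzBl; apply: closedMz. Qed.

End ZmodClosed.

(** Lists in [Zspan] may repeat entries. Regrouping by multiplicity over a duplicate-free list gives
    two combinations a common support, so that their coefficients can be added. *)
Lemma sum_count_mem (V : nmodType) (I : eqType) (F : I -> V) (s r : seq I) :
  uniq r -> {subset s <= r} ->
  \sum_(i <- s) F i = \sum_(i <- r) F i *+ count_mem i s.
Proof.
move=> ur; elim: s => [|x s IHs] sub; first by rewrite big_nil big1.
rewrite big_cons IHs => [|i si]; last by apply: sub; rewrite inE si orbT.
under [RHS]eq_bigr => i _ do rewrite /= mulrnDr.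
rewrite big_split /=; congr (_ + _).
rewrite (bigD1_seq x) ?sub ?mem_head //= eqxx mulr1n big1 ?addr0 // => i.
by rewrite eq_sym => /negPf ->.
Qed.

Section Span.
Variable U : algType rat.
Implicit Types (B V P S : U -> Prop) (x y : U).

Lemma Zspan_in B x : B x -> Zspan B x.
Proof.
move=> Bx; exists [:: x], (fun=> 1); split; last by rewrite big_seq1.
by move=> b; rewrite inE => /eqP ->.
Qed.

Lemma Zspan0 B : Zspan B 0.
Proof. by exists [::], (fun=> 0); split; last by rewrite big_nil. Qed.

Lemma ZspanD B x y : Zspan B x -> Zspan B y -> Zspan B (x + y).
Proof.
move=> [s [c [Bs ->]]] [t [d [Bt ->]]].
exists (undup (s ++ t)), (fun b => c b *+ count_mem b s + d b *+ count_mem b t).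
split=> [b|]; first by rewrite mem_undup mem_cat => /orP[/Bs|/Bt].
have sub1 : {subset s <= undup (s ++ t)} by move=> b; rewrite mem_undup mem_cat => ->.
have sub2 : {subset t <= undup (s ++ t)}.
  by move=> b; rewrite mem_undup mem_cat orbC => ->.
have ur := undup_uniq (s ++ t).
rewrite (sum_count_mem _ ur sub1) (sum_count_mem _ ur sub2).
rewrite -big_split; apply: eq_bigr => b _ /=.
have E z n : b *~ (z *+ n) = b *~ z *+ n by rewrite -mulr_natr natz mulrzA.
by rewrite mulrzDr !E.
Qed.

Lemma ZspanMz B x z : Zspan B x -> Zspan B (x *~ z).
Proof.
move=> [s [c [Bs ->]]]; exists s, (fun b => c b * z); split=> //.
by rewrite mulrz_suml; apply: eq_bigr => b _; rewrite mulrzA.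
Qed.

Lemma ZspanB B x y : Zspan B x -> Zspan B y -> Zspan B (x - y).
Proof. by move=> Bx By; apply: ZspanD => //; rewrite -mulrN1z; apply: ZspanMz. Qed.

Lemma ZspanZ B c x : c \is a Num.int -> Zspan B x -> Zspan B (c *: x).
Proof. by move=> /intrP[z ->] Bx; rewrite scaler_int; apply: ZspanMz. Qed.

Lemma Zspan_min B P : P 0 -> (forall x y, P x -> P y -> P (x - y)) ->
  (forall x, B x -> P x) -> forall x, Zspan B x -> P x.
Proof.
move=> P0 PB PBx x [s [c [Bs ->]]].
rewrite big_seq; elim/big_ind: _ => // [y z|b /Bs/PBx]; first exact: closedD.
exact: closedMz.
Qed.

Lemma Zspan_sum B (I : eqType) (s : seq I) (Q : pred I) (F : I -> U) :
  (forall i, i \in s -> Q i -> Zspan B (F i)) -> Zspan B (\sum_(i <- s | Q i) F i).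
Proof.
move=> BF; rewrite big_seq_cond; elim/big_ind: _ => [|x y|i /andP[]].
- exact: Zspan0.
- exact: ZspanD.
- exact: BF.
Qed.

Lemma Zspan_mono B B' x : (forall y, B y -> Zspan B' y) -> Zspan B x -> Zspan B' x.
Proof. by move=> BB'; apply: Zspan_min BB' x; [exact: Zspan0|exact: ZspanB]. Qed.

Lemma subring_gen_subring S : is_subring (subring_gen S).
Proof.
split; [exact: subring_gen1|exact: subring_genB|exact: subring_genM].
Qed.

Lemma subring_gen_min S P : is_subring P -> (forall x, S x -> P x) ->
  forall x, subring_gen S x -> P x.
Proof. by move=> [P1 PB PM] PS x; elim=> //; auto. Qed.

Lemma subring0 V : is_subring V -> V 0.
Proof. by case=> V1 VB _; rewrite -(subrr 1); apply: VB. Qed.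

Lemma Zspan_subring V B : is_subring V -> (forall x, B x -> V x) ->
  forall x, Zspan B x -> V x.
Proof. by move=> sV BV; apply: Zspan_min BV; [exact: subring0|case: sV]. Qed.

Lemma subringZ V c x : is_subring V -> c \is a Num.int -> V x -> V (c *: x).
Proof.
move=> sV ci Vx; apply: (Zspan_subring sV (B := fun y => y = x)); first by move=> y ->.
exact/ZspanZ/Zspan_in.
Qed.

Lemma subring_sum V (I : eqType) (s : seq I) (Q : pred I) (F : I -> U) :
  is_subring V -> (forall i, i \in s -> Q i -> V (F i)) ->
  V (\sum_(i <- s | Q i) F i).
Proof.
move=> sV BF; apply: (Zspan_subring sV (B := V)) => //.
by apply: Zspan_sum => i si Qi; apply/Zspan_in/BF.
Qed.

Lemma subring_prod V (I : eqType) (s : seq I) (Q : pred I) (F : I -> U) :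
  is_subring V -> (forall i, i \in s -> Q i -> V (F i)) ->
  V (\prod_(i <- s | Q i) F i).
Proof.
move=> [V1 _ VM] BF; rewrite big_seq_cond.
by elim/big_ind: _ => // i /andP[]; apply: BF.
Qed.

End Span.

Lemma common_denominator (I : eqType) (s : seq I) (p : I -> rat) :
  exists2 q : rat, q != 0 & forall i, i \in s -> exists a : int, p i = q *~ a.
Proof.
suff [d d0 dP] : exists2 d : int, d != 0 &
    forall i, i \in s -> exists a : int, p i * d%:~R = a%:~R.
  have d1 : d%:~R != 0 :> rat by rewrite intr_eq0.
  exists (d%:~R^-1); first by rewrite invr_eq0.
  move=> i /dP[a E]; exists a; rewrite -mulrzr -E mulrC mulfK //.
elim: s => [|i s [d d0 ds]]; first by exists 1.
exists (d * denq (p i)); first by rewrite mulf_neq0 ?denq_neq0.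
move=> j; rewrite inE => /orP[/eqP ->|/ds[a E]].
  exists (d * numq (p i)); rewrite !rmorphM /= mulrCA; congr (_ * _).
  by rewrite -numqE.
by exists (a * denq (p i)); rewrite !rmorphM mulrA E.
Qed.

Section Collapse.
Variables (U : lmodType rat) (V : U -> Prop) (G : zmodType) (e : rat -> U -> G).
Variable R : G -> Prop.
Hypotheses (V0 : V 0) (VB : forall x y, V x -> V y -> V (x - y)).
Hypotheses (R0 : R 0) (RB : forall g g', R g -> R g' -> R (g - g')).
Hypothesis RDr : forall p x y, V x -> V y -> R (e p (x + y) - e p x - e p y).
Hypothesis RZ : forall p (n : int) x, V x -> R (e (p *~ n) x - e p (x *~ n)).

Lemma rel_add q x y : V x -> V y -> R (e q (x + y) - (e q x + e q y)).
Proof. by rewrite opprD addrA; apply: RDr. Qed.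

Lemma rel_zero q : R (e q 0).
Proof.
have := closedN R0 RB (RDr q V0 V0).
by rewrite addr0 subrr sub0r opprK.
Qed.

Lemma rel_mulz q x n : V x -> R (e q x *~ n - e q (x *~ n)).
Proof.
move=> Vx; have Mn m : R (e q x *+ m - e q (x *+ m)).
  elim: m => [|m IHm].
    by rewrite !mulr0n sub0r; apply/(closedN R0 RB)/rel_zero.
  rewrite !mulrS; apply: (cong_trans R0 RB (b := e q x + e q (x *+ m))).
    by apply: (congD R0 RB) IHm; rewrite subrr.
  by apply/(cong_sym R0 RB)/rel_add => //; rewrite pmulrn; apply: closedMz.
case: n => n; first exact: Mn.
have Vn : V (x *+ n.+1) by rewrite pmulrn; apply: closedMz.
rewrite NegzE !mulrNz -!pmulrn -opprD; apply: (closedN R0 RB).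
rewrite -[_ + _]subr0; apply: (cong_trans R0 RB (b := e q 0)).
  apply: (cong_trans R0 RB (b := e q (x *+ n.+1) + e q (- (x *+ n.+1)))).
    by apply: (congD R0 RB) (Mn _) _; rewrite subrr.
  apply: (cong_sym R0 RB); rewrite -[X in e q X](addrN (x *+ n.+1)).
  by apply: rel_add => //; apply: closedN.
by rewrite subr0; apply: rel_zero.
Qed.

(** Here [e p x] plays the pure tensor of p and x, and [R] the subgroup of relations. With a common
    denominator q, each p is q a with a an integer, and a moves to the right factor; all terms then
    share the left factor q and add up to one pure tensor. *)
Lemma rel_collapse (s : seq (rat * U)) (c : rat * U -> int) :
  (forall p, p \in s -> V p.2) ->
  exists q y, [/\ q != 0, V y & R (\sum_(p <- s) e p.1 p.2 *~ c p - e q y)].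
Proof.
move=> sV; have [q q0 qs] := common_denominator s (fun p => p.1).
exists q; elim: s sV qs => [|p s IHs] sV qs.
  by exists 0; split=> //; rewrite big_nil sub0r; apply/(closedN R0 RB)/rel_zero.
have [||y [_ Vy Ry]] := IHs.
- by move=> r rs; apply: sV; rewrite inE rs orbT.
- by move=> r rs; apply: qs; rewrite inE rs orbT.
have [a pa] := qs p (mem_head _ _); have Vp := sV p (mem_head _ _).
have Vpa : V (p.2 *~ a) by apply: closedMz.
have Vpac : V (p.2 *~ a *~ c p) by apply: closedMz.
exists (p.2 *~ a *~ c p + y); split=> //; first exact: closedD.
rewrite big_cons; apply: (cong_trans R0 RB (b := e q (p.2 *~ a *~ c p) + e q y)).
  apply: (congD R0 RB) Ry; apply: (cong_trans R0 RB) (rel_mulz q (c p) Vpa).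
  by apply: (congMz R0 RB); rewrite pa; apply: RZ.
by apply: (cong_sym R0 RB); apply: rel_add.
Qed.

End Collapse.

Section TensorEvaluation.
Variables (U : algType rat) (V : U -> Prop).
Hypotheses (sV : is_subring V) (VQ : forall x, exists n, V (x *+ n.+1)).

(** Injectivity: a formal sum is congruent to a pure tensor of some q != 0 and y, whose value q y is
    0, so y = 0 and the tensor is a relation. Surjectivity: x is 1/(n+1) times an element of [V]. *)
Lemma tensor_eval_bij : tensor_eval_bijective V.
Proof.
have [V1 VB _] := sV; have V0 := subring0 sV.
split=> [g gV g0|x]; last first.
  have [n Vn] := VQ x; exists << (n.+1%:R^-1, x *+ n.+1) >>.
    by move=> p /(fsubsetP msuppU_le); rewrite inE => /eqP ->.
  rewrite tensor_evalU /= -scaler_nat scalerA mulVf ?scale1r //.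
  by rewrite pnatr_eq0.
pose e (p : rat) (x : U) : {malg int[(rat * U)%type]} := << (p, x) >>.
have [q [y [q0 Vy Ry]]] := rel_collapse (e := e) V0 VB
  (tensor_rel0 V) (@tensor_relB _ V) (@tensor_relDr _ V) (@tensor_relZ _ V)
  (fun p => g@_p) gV.
have gE : \sum_(p <- msupp g) e p.1 p.2 *~ g@_p = g.
  rewrite [RHS]monalgE; apply: eq_bigr => -[p x] _.
  by rewrite /e -raddfMz /= intz.
rewrite gE in Ry; have := tensor_rel_eval Ry.
rewrite tensor_evalB g0 sub0r tensor_evalU /= => /eqP.
rewrite oppr_eq0 scaler_eq0 (negPf q0) /= => /eqP y0.
rewrite -(subrK (e q y) g); apply: (closedD (tensor_rel0 V) (@tensor_relB _ V)) => //.
rewrite y0.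
exact: (rel_zero V0 (tensor_rel0 V) (@tensor_relB _ V) (@tensor_relDr _ V)).
Qed.

End TensorEvaluation.

(** * Monomials, torsion and the substitution of -u^2 *)

Lemma mmulI (I : choiceType) (u k l : {cmonom I}) : (mmul u k == mmul u l) = (k == l).
Proof.
apply/eqP/eqP => [/eqP/cmP E|->//]; apply/eqP/cmP => i.
by apply/eqP; rewrite -(eqn_add2l (u i)) -!cmM E.
Qed.

Lemma ucm_divK (I : choiceType) r (k : {cmonom I}) : k r != 0%N ->
  k = mmul (ucm r) (divcm k (ucm r)).
Proof.
move=> kr; apply/eqP/cmP => j; rewrite cmM divcmE cmU.
case: eqP => [<-|_]; last by rewrite subn0.
by rewrite subnKC // lt0n.
Qed.

Lemma cmonom_ind (I : choiceType) (P : {cmonom I} -> Prop) :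
  P mone -> (forall i k, P k -> P (mmul (ucm i) k)) -> forall k, P k.
Proof.
move=> P1 PU k; move: {2}(mdeg k) (leqnn (mdeg k)) => n.
elim: n k => [|n IHn] k.
  by rewrite leqn0 => /eqP /mdeg_eq0I ->.
have [->//|k1 lek] := eqVneq k mone.
have [i ik] : exists i, i \in finsupp k.
  apply/fset0Pn/negP => /eqP k0; case/negP: k1.
  by rewrite -mdeg_eq0 mdegE k0 big_seq_fset0.
have kE : k = mmul (ucm i) (divcm k (ucm i)) by rewrite -ucm_divK ?cmE_neq0.
rewrite kE; apply/PU/IHn; move: lek.
by rewrite {1}kE mdegM mdegU add1n ltnS.
Qed.

Lemma cmonom_big (I : Type) (s : seq I) (u : I -> {cmonom posint}) j :
  (\big[mmul/mone]_(i <- s) u i : {cmonom posint}) j = (\sum_(i <- s) u i j)%N.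
Proof.
elim: s => [|i s IHs]; first by rewrite !big_nil cm1.
by rewrite !big_cons cmM IHs.
Qed.

Definition posS n : posint := PosInt (ltn0Sn n).

Lemma posSE (r : posint) : r = posS r.-1.
Proof. by apply: val_inj => /=; rewrite prednK ?posint_gt0. Qed.

Lemma torsion_free_lmod (V : lmodType rat) : torsion_free V.
Proof.
move=> x n xn0; have n1 : n.+1%:R != 0 :> rat by rewrite pnatr_eq0.
by rewrite -[x](scalerK n1) scaler_nat xn0 scaler0.
Qed.

Lemma torsion_free_poly (R : nzRingType) :
  torsion_free R -> torsion_free {poly R}.
Proof.
move=> tf p n /polyP pn0; apply/polyP => i; rewrite coef0.
by apply: (tf _ n); rewrite -coefMn pn0 coef0.
Qed.

Lemma scaler_divMn (V : lmodType rat) (c : rat) (v : V) n :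
  ((c / n.+1%:R) *: v) *+ n.+1 = c *: v.
Proof. by rewrite scalerMnl -mulr_natr divfK // pnatr_eq0. Qed.

Lemma sum_double (R : nmodType) (F : nat -> R) n :
  \sum_(i < n.*2) F i = \sum_(j < n) (F j.*2 + F j.*2.+1).
Proof.
elim: n => [|n IHn]; first by rewrite !big_ord0.
by rewrite doubleS !big_ord_recr /= IHn addrA.
Qed.

(* E(-u^2). *)
Lemma newton_even (R : comNzRingType) (p G : nat -> R) :
  newton p G ->
  newton (fun i => if odd i then (-1) ^+ (i./2).+1 * p i./2 *+ 2 else 0)
         (fun n => if odd n then 0 else (-1) ^+ n./2 * G n./2).
Proof.
move=> [G0 GS]; split=> [|n]; first by rewrite /= mul1r.
have [no|ne] := boolP (odd n); last first.
  rewrite /= (negPf ne) mul0rn big1 // => -[i /= lti] _.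
  have [io|ie] := boolP (odd i); last by rewrite mul0r.
  by rewrite oddB // (negPf ne) io /= mulr0.
(* For n = 2k+1 only the indices i = 2j+1 contribute, which leaves the recursion of G at k+1. *)
have := odd_double_half n; rewrite no add1n => <-.
move: n./2 => k; rewrite -doubleS.
rewrite (sum_double (fun i => (if odd i then (-1) ^+ (i./2).+1 * p i./2 *+ 2 else 0) *
   (if odd (k.*2.+1 - i) then 0 else (-1) ^+ (k.*2.+1 - i)./2
      * G (k.*2.+1 - i)%N./2))).
rewrite odd_double doubleK -mul2n mulrnA mulrnAC -mulrnAr GS mulr_sumr -sumrMnl.
apply: eq_bigr => -[j /= ltj] _.
rewrite !odd_double /= mul0r add0r subSS -doubleB odd_double doubleK uphalf_double.
rewrite mulrnAl mulrACA; congr (_ * _ *+ 2).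
by rewrite -exprD addSn subnKC.
Qed.

(** * Integral elements of a polynomial algebra *)

(* A polynomial algebra on the [X r] is given by its coefficient functionals and
   its universal property: unification on the concrete type [Qh] is intractable,
   as it unfolds down to the representation of finitely supported functions. *)
Section PolynomialAlgebra.
Variables (A : comAlgType rat) (X : posint -> A).

Definition Xmon (k : {cmonom posint}) : A := \prod_(r <- finsupp k) X r ^+ k r.

Variable co : {cmonom posint} -> {scalar A}.
Hypothesis co_Xmon : forall k l, co l (Xmon k) = (k == l)%:R.
Hypothesis coE : forall f, exists2 s, uniq s & f = \sum_(k <- s) co k f *: Xmon k.

Hypothesis ev_ex : forall (S : comNzRingType) (f : {rmorphism rat -> S})
  (c : posint -> S), {e : {rmorphism A -> S} |
    (forall x, e x%:A = f x) & (forall r, e (X r) = c r)}.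

Variable lam : posint -> {rmorphism A -> A}.
Hypothesis lamZ : forall m c f, lam m (c *: f) = c *: lam m f.
Hypothesis lam_X : forall m r, lam m (X r) = X (posint_mul m r).

Lemma Xmon1 : Xmon mone = 1.
Proof. by rewrite /Xmon mdom1 big_seq_fset0. Qed.

Lemma XmonM (k l : {cmonom posint}) : Xmon (mmul k l) = Xmon k * Xmon l.
Proof.
have E (d : {fset posint}) (k' : {cmonom posint}) : (finsupp k' `<=` d)%fset ->
    Xmon k' = \prod_(r <- d) X r ^+ k' r.
  move=> sub; rewrite /Xmon (big_fset_incl _ sub) // => r _.
  by rewrite -cmE_eq0 => /eqP ->; rewrite expr0.
rewrite (E _ _ (fsubset_refl _)) mdomD (E _ k (fsubsetUl _ (finsupp l))).
rewrite (E _ l (fsubsetUr (finsupp k) _)) -big_split /=.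
by apply: eq_bigr => r _; rewrite cmM exprD.
Qed.

Lemma XmonU r : Xmon (ucm r) = X r.
Proof. by rewrite /Xmon mdomU big_seq_fset1 cmUU expr1. Qed.

Lemma poly_ind (P : A -> Prop) :
  (forall c, P c%:A) -> (forall r, P (X r)) ->
  (forall f g, P f -> P g -> P (f + g)) ->
  (forall f g, P f -> P g -> P (f * g)) -> forall f, P f.
Proof.
move=> PC Ph PD PM f; have [s _ ->] := coE f.
elim/big_ind: _ => [|//|k _]; first by rewrite -[0](scale0r 1).
rewrite -mulr_algl; apply: (PM) => //.
elim/cmonom_ind: k => [|i k Pk]; first by rewrite Xmon1 -[1]scale1r.
by rewrite XmonM XmonU; apply: PM.
Qed.

Lemma torsion_free_A : torsion_free A.
Proof. exact: torsion_free_lmod. Qed.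

(** This and [hgenA], [mix_genA], [bprime] below repeat the shape of the concrete definitions, so
    that specialising the algebra to [Qh] recovers them by conversion. *)
Definition log_serA (a : posint -> rat) (n : nat) : A :=
  if insub n is Some r then ((-1) ^+ n.-1 * a r / n%:R) *: X r else 0.

Definition hgenA (a : posint -> rat) : nat -> A := fps_exp (log_serA a).

Lemma log_serAS a n :
  log_serA a n.+1 *+ n.+1 = ((-1) ^+ n * a (posS n)) *: X (posS n).
Proof.
have E : insub n.+1 = Some (posS n).
  by rewrite insubT; congr Some; apply: val_inj.
by rewrite /log_serA E scaler_divMn.
Qed.

Lemma newton_hgenA a :
  newton (fun i => ((-1) ^+ i * a (posS i)) *: X (posS i)) (hgenA a).
Proof.
have f0 : log_serA a 0%N = 0 by rewrite /log_serA insubF.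
exact: (newton_ext (log_serAS a) (frefl _) (newton_fps_exp f0)).
Qed.

(* lambda_m of the series with constant weights c: c = 1 gives hat h and
   c = 1/2 gives check h. *)
Definition lamhat c m n : A := lam m (hgenA (fun=> c) n).

Lemma newton_lamhat c m :
  newton (fun i => ((-1) ^+ i * c) *: X (posint_mul m (posS i))) (lamhat c m).
Proof.
apply: (newton_ext _ (frefl _) (newton_morph (lam m) (newton_hgenA (fun=> c)))) => i.
by rewrite /= lamZ lam_X.
Qed.

Lemma lamhat0 c m : lamhat c m 0%N = 1.
Proof. exact: (proj1 (newton_lamhat c m)). Qed.

Lemma lamA m c : lam m c%:A = c%:A.
Proof. by rewrite lamZ rmorph1. Qed.

Lemma lam_comp m n f : lam m (lam n f) = lam (posint_mul m n) f.
Proof.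
elim/poly_ind: f => [c|r|f g IHf IHg|f g IHf IHg].
- by rewrite !lamA.
- by rewrite !lam_X; congr X; apply: val_inj; rewrite /= mulnA.
- by rewrite !rmorphD IHf IHg.
- by rewrite !rmorphM IHf IHg.
Qed.

Lemma lam1 f : lam (posS 0%N) f = f.
Proof.
elim/poly_ind: f => [c|r|f g IHf IHg|f g IHf IHg].
- by rewrite !lamA.
- by rewrite !lam_X; congr X; apply: val_inj; rewrite /= mul1n.
- by rewrite !rmorphD IHf IHg.
- by rewrite !rmorphM IHf IHg.
Qed.

Lemma hgenAE c n : hgenA (fun=> c) n = lamhat c (posS 0%N) n.
Proof. by rewrite /lamhat lam1. Qed.

Lemma lam_lamhat c m n k : lam m (lamhat c n k) = lamhat c (posint_mul m n) k.
Proof. exact: lam_comp. Qed.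

Definition dilate c : {rmorphism A -> A} :=
  s2val (ev_ex (GRing.in_alg A) (fun r => c *: X r)).

Lemma dilate_X c r : dilate c (X r) = c *: X r.
Proof. by rewrite /dilate; case: ev_ex. Qed.

Lemma dilateA c d : dilate c d%:A = d%:A.
Proof. by rewrite /dilate; case: ev_ex. Qed.

Lemma dilateZ c d f : dilate c (d *: f) = d *: dilate c f.
Proof. by rewrite -mulr_algl rmorphM dilateA mulr_algl. Qed.

Lemma dilate_lamhat c m n : dilate c (lamhat 1 m n) = lamhat c m n.
Proof.
move: n; apply: newton_uniq torsion_free_A _ (newton_lamhat c m).
apply: (newton_ext _ (frefl _) (newton_morph (dilate c) (newton_lamhat 1 m))) => i.
by rewrite /= dilateZ dilate_X scalerA mulr1.
Qed.

Lemma lamhat_conv m n :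
  lamhat 1 m n = \sum_(i < n.+1) lamhat (1 / 2) m i * lamhat (1 / 2) m (n - i).
Proof.
have E := newton_lamhat (1 / 2) m.
move: n; apply: newton_uniq torsion_free_A (newton_lamhat 1 m) _.
apply: (newton_ext _ (frefl _) (newton_conv E E)) => i.
by rewrite /= -scalerDl -mulrDr -splitr.
Qed.

(** As series, bar h(u) is lambda_2 of check h evaluated at -u^2: both logarithms are - sum_s h_(2s)
    u^(2s) / (2s). *)
Lemma barhE n : hgenA (fun r => if odd r then 0 else 1) n =
  if odd n then 0 else (-1) ^+ n./2 * lamhat (1 / 2) (posS 1%N) n./2.
Proof.
move: n; apply: newton_uniq torsion_free_A (newton_hgenA _) _.
apply: (newton_ext _ (frefl _) (newton_even (newton_lamhat (1 / 2) (posS 1%N)))) => i.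
rewrite /=; case: ifP => [io|ie] /=; last by rewrite mulr0 scale0r.
have iE := odd_double_half i; rewrite io add1n in iE.
have -> : posint_mul (posS 1%N) (posS i./2) = posS i.
  by apply: val_inj; rewrite /= mul2n doubleS iE.
have e2 : ((-1) ^+ i./2 * (1 / 2)) *+ 2 = (-1) ^+ i./2 :> rat.
  by rewrite -mulr_natr -mulrA div1r mulVf // mulr1.
rewrite -mulrnAr scalerMnl e2 -(signr_odd _ i) io mulr1 expr1 scaleN1r exprS.
rewrite mulN1r mulNr; congr (- _).
by rewrite -signr_odd -(signr_odd rat); case: odd;
  rewrite ?scaleN1r ?scale1r ?mulrNN mul1r.
Qed.

(* On symmetric functions: split off one variable. *)
Definition addvar : {rmorphism A -> {poly A}} :=
  s2val (ev_ex (polyC \o GRing.in_alg A) (fun r => (X r)%:P + 'X^r)).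

Lemma addvar_X r : addvar (X r) = (X r)%:P + 'X^r.
Proof. by rewrite /addvar; case: ev_ex. Qed.

Lemma addvarA c : addvar c%:A = (c%:A)%:P.
Proof. by rewrite /addvar; case: ev_ex. Qed.

Lemma addvarZ c f : addvar (c *: f) = (c%:A)%:P * addvar f.
Proof. by rewrite -[c *: f]mulr_algl [LHS]rmorphM addvarA. Qed.

(** A new variable y multiplies the generating series of the elementary symmetric functions of the
    x_i^m by 1 + y^m u. *)
Lemma addvar_lamhat m n : addvar (lamhat 1 m n) =
  (lamhat 1 m n)%:P + (if n is n'.+1 then 'X^m * (lamhat 1 m n')%:P else 0).
Proof.
have E := newton_lamhat 1 m.
move: n; apply: (newton_uniq (torsion_free_poly torsion_free_A)); last first.
  exact: newton_mul1 'X^m _ _ (newton_morph polyC E).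
apply: (newton_ext _ (frefl _) (newton_morph addvar E)) => i.
have sE : (((-1) ^+ i)%:A)%:P = (-1) ^+ i :> {poly A}.
  rewrite -(signr_odd rat) -[in RHS]signr_odd.
  by case: odd; rewrite ?expr0 ?expr1 ?scaleN1r ?scale1r ?polyCN ?polyC1.
rewrite /= addvarZ addvar_X mulr1 mulrDr sE -exprM; congr (_ + _).
by rewrite -[in RHS]mulr_algl polyCM sE.
Qed.

(** On symmetric functions this is the adjoint, for the Hall product, of multiplication by the
    complete homogeneous function of degree a. *)
Definition skew a f : A := (addvar f)`_a.

Lemma skewB a f g : skew a (f - g) = skew a f - skew a g.
Proof. by rewrite /skew rmorphB coefB. Qed.

Lemma skewZ a c f : skew a (c *: f) = c *: skew a f.
Proof. by rewrite /skew addvarZ coefCM mulr_algl. Qed.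

Lemma skewM a f g :
  skew a (f * g) = \sum_(i < a.+1) skew i f * skew (a - i)%N g.
Proof. by rewrite /skew rmorphM coefM. Qed.

Lemma skew_sum a (I : Type) (s : seq I) (Q : pred I) (F : I -> A) :
  skew a (\sum_(i <- s | Q i) F i) = \sum_(i <- s | Q i) skew a (F i).
Proof. by rewrite /skew rmorph_sum coef_sum. Qed.

Lemma skew_lamhat a m n : skew a (lamhat 1 m n) = lamhat 1 m n *+ (a == 0%N) +
  (if n is n'.+1 then lamhat 1 m n' *+ (a == m) else 0).
Proof.
rewrite /skew addvar_lamhat coefD coefC -mulrb; congr (_ + _).
case: n => [|n]; first by rewrite coef0.
by rewrite coefMC coefXn mulr_natl.
Qed.

Lemma skew0 f : skew 0%N f = f.
Proof.
rewrite /skew; elim/poly_ind: f => [c|r|f g IHf IHg|f g IHf IHg].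
- by rewrite addvarA coefC.
- by rewrite addvar_X coefD coefC coefXn (ltn_eqF (posint_gt0 r)) /= addr0.
- by rewrite rmorphD coefD IHf IHg.
- by rewrite rmorphM coef0M IHf IHg.
Qed.

Definition augm : {rmorphism A -> rat} := s2val (ev_ex idfun (fun=> 0)).

Lemma augm_X r : augm (X r) = 0.
Proof. by rewrite /augm; case: ev_ex. Qed.

Lemma augmA c : augm c%:A = c.
Proof. by rewrite /augm; case: ev_ex. Qed.

Lemma augmZ c f : augm (c *: f) = c * augm f.
Proof. by rewrite -[c *: f]mulr_algl rmorphM augmA. Qed.

Lemma augm_lamhat c m n : augm (lamhat c m n) = (n == 0%N)%:R.
Proof.
have [E0 ES] := newton_lamhat c m.
case: n => [|n]; first by rewrite E0 rmorph1.
apply: (torsion_free_lmod (V := rat^o) (n := n)).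
rewrite -(rmorphMn augm) ES rmorph_sum big1 // => i _.
by rewrite rmorphM augmZ augm_X mulr0 mul0r.
Qed.

Fixpoint skews (s : seq nat) f : A := if s is a :: s' then skews s' (skew a f) else f.

Lemma skews_sum s (I : Type) (r : seq I) (Q : pred I) (F : I -> A) :
  skews s (\sum_(i <- r | Q i) F i) = \sum_(i <- r | Q i) skews s (F i).
Proof. by elim: s F => //= a s IHs F; rewrite skew_sum IHs. Qed.

Lemma skewsB s f g : skews s (f - g) = skews s f - skews s g.
Proof. by elim: s f g => //= a s IHs f g; rewrite skewB IHs. Qed.

(* [augm (skews s f)] is the coefficient of prod_i x_i^(s_i) in f. *)
Definition integral f := forall s, augm (skews s f) \is a Num.int.

Lemma integral_skew a f : integral f -> integral (skew a f).
Proof. by move=> Lf s; apply: (Lf (a :: s)). Qed.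

Lemma integralM f g : integral f -> integral g -> integral (f * g).
Proof.
move=> Lf Lg s; elim: s f g Lf Lg => [|a s IHs] f g Lf Lg /=.
  by rewrite rmorphM rpredM //; [apply: (Lf [::])|apply: (Lg [::])].
rewrite skewM skews_sum rmorph_sum rpred_sum // => i _.
by apply: IHs; apply: integral_skew.
Qed.

Lemma integralB f g : integral f -> integral g -> integral (f - g).
Proof. by move=> Lf Lg s; rewrite skewsB rmorphB rpredB. Qed.

(** Each [skew] sends such an element to itself, to the one of index n - 1, or to 0, and the
    constant terms are 0 or 1. *)
Lemma integral_lamhat m n : integral (lamhat 1 m n).
Proof.
move=> s; elim: s n => [|a s IHs] n /=; first by rewrite augm_lamhat rpred_nat.
have d0 : augm (skews s 0) \is a Num.int.
  by rewrite -(subrr 0) skewsB subrr rmorph0 rpred0.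
rewrite skew_lamhat; have [->|a0] := eqVneq a 0%N.
  by case: n => [|n]; rewrite ?(ltn_eqF (posint_gt0 m)) /= addr0; apply: IHs.
rewrite add0r; case: n => // n; case: eqP => _ //.
exact: IHs.
Qed.

Lemma integral1 : integral 1.
Proof. by rewrite -(lamhat0 1 (posS 0%N)); apply: integral_lamhat. Qed.

Lemma integral_subring : is_subring integral.
Proof. by split; [exact: integral1|exact: integralB|exact: integralM]. Qed.

(** * Degrees and leading terms *)

Lemma co_notin s f k : uniq s -> f = \sum_(l <- s) co l f *: Xmon l ->
  k \notin s -> co k f = 0.
Proof.
move=> us fE ks; rewrite fE linear_sum big_seq big1 // => l ls.
rewrite linearZ /= co_Xmon; case: eqP => [lk|_]; last by rewrite mulr0.
by rewrite -lk ls in ks.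
Qed.

Lemma co_sum s (Q : pred {cmonom posint}) (F : {cmonom posint} -> rat) k :
  uniq s -> co k (\sum_(l <- s | Q l) F l *: Xmon l) =
  if (k \in s) && Q k then F k else 0.
Proof.
move=> us; rewrite linear_sum; under eq_bigr do rewrite linearZ /= co_Xmon.
have E0 : (k \in s) && Q k = false ->
    \sum_(i <- s | Q i) F i * (i == k)%:R = 0.
  move=> kF; rewrite big_seq_cond big1 // => i /andP[si Qi].
  case: eqP => [ik|_]; last by rewrite mulr0.
  by rewrite -ik si Qi in kF.
case: ifP => // /andP[sk Qk].
rewrite big_mkcond (bigD1_seq k) //= Qk eqxx mulr1 big1 ?addr0 // => i ik.
by rewrite (negPf ik) mulr0 if_same.
Qed.

(* The degree of a monomial counts the variables [X r], all with weight 1. *)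
Definition deg_lt d f := forall k, (d <= mdeg k)%N -> co k f = 0.

Lemma deg_ltB d f g : deg_lt d f -> deg_lt d g -> deg_lt d (f - g).
Proof. by move=> df dg k dk; rewrite linearB /= df ?dg // subr0. Qed.

Lemma deg_ltD d f g : deg_lt d f -> deg_lt d g -> deg_lt d (f + g).
Proof. by move=> df dg k dk; rewrite linearD /= df ?dg // addr0. Qed.

Lemma deg_ltZ d c f : deg_lt d f -> deg_lt d (c *: f).
Proof. by move=> df k dk; rewrite linearZ /= df // mulr0. Qed.

Lemma deg_lt_sum d (I : Type) (s : seq I) (Q : pred I) (F : I -> A) :
  (forall i, Q i -> deg_lt d (F i)) -> deg_lt d (\sum_(i <- s | Q i) F i).
Proof.
move=> dF; elim/big_ind: _ => // [k _|]; [exact: linear0|exact: deg_ltD].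
Qed.

Lemma deg_lt_Xmon k : deg_lt (mdeg k).+1 (Xmon k).
Proof. by move=> l kl; rewrite co_Xmon; case: eqP kl => // ->; rewrite ltnn. Qed.

Lemma deg_ltW d e f : (d <= e)%N -> deg_lt d f -> deg_lt e f.
Proof. by move=> de df k ek; apply/df/(leq_trans de). Qed.

(** The bounds are strict: the degrees are at most d - 1 and e - 1, whence the slack of one in the
    hypothesis. *)
Lemma deg_ltM d e n f g : (d + e <= n.+1)%N ->
  deg_lt d f -> deg_lt e g -> deg_lt n (f * g).
Proof.
move=> den df dg; have [s us fE] := coE f; have [t ut gE] := coE g.
rewrite fE mulr_suml; apply: deg_lt_sum => k _.
have [dk|kd] := leqP d (mdeg k).
  by rewrite df // scale0r mul0r => l _; apply: linear0.
rewrite gE mulr_sumr; apply: deg_lt_sum => l _.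
have [el|le] := leqP e (mdeg l).
  by rewrite dg // scale0r mulr0 => l' _; apply: linear0.
rewrite -scalerAl -scalerAr -XmonM; apply: deg_ltZ; apply: deg_ltZ.
by apply: (deg_ltW _ (@deg_lt_Xmon (mmul k l))); rewrite mdegM; lia.
Qed.

(** The degree takes the place of a monomial order, as the top homogeneous part of each basis
    product is a single term. *)
Definition lead k c f := deg_lt (mdeg k) (f - c *: Xmon k).

Lemma lead_deg_lt k c f : lead k c f -> deg_lt (mdeg k).+1 f.
Proof.
move=> kf; rewrite -(subrK (c *: Xmon k) f); apply: deg_ltD.
  exact: (deg_ltW (leqnSn _) kf).
exact/deg_ltZ/deg_lt_Xmon.
Qed.

Lemma lead_co k c f l : lead k c f -> (mdeg k <= mdeg l)%N ->
  co l f = c * (k == l)%:R.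
Proof.
move=> kf kl; apply/eqP; rewrite -subr_eq0 -(kf l kl).
by rewrite linearB linearZ /= co_Xmon.
Qed.

Lemma lead1 : lead mone 1 1.
Proof. by move=> k _; rewrite Xmon1 scale1r subrr; apply: linear0. Qed.

Lemma lead_X r : lead (ucm r) 1 (X r).
Proof. by move=> k _; rewrite XmonU scale1r subrr; apply: linear0. Qed.

Lemma leadM k l c d f g : lead k c f -> lead l d g ->
  lead (mmul k l) (c * d) (f * g).
Proof.
move=> kf lg; rewrite /lead mdegM XmonM.
have -> : f * g - (c * d) *: (Xmon k * Xmon l) =
    (f - c *: Xmon k) * g + (c *: Xmon k) * (g - d *: Xmon l).
  by rewrite mulrBl mulrBr addrA subrK -scalerAl -scalerAr scalerA.
apply: deg_ltD; first by apply: (deg_ltM _ kf (lead_deg_lt lg)); rewrite addnS.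
have kk := deg_ltZ c (@deg_lt_Xmon k).
by apply: (@deg_ltM _ _ _ _ _ _ kk lg); rewrite addSn.
Qed.

Lemma leadZ a k c f : lead k c f -> lead k (a * c) (a *: f).
Proof. by move=> kf; rewrite /lead -scalerA -scalerBr; apply: deg_ltZ. Qed.

Definition cpow r n : {cmonom posint} := iter n (mmul (ucm r)) mone.

Lemma cpowE r n j : cpow r n j = (n * (r == j))%N.
Proof.
elim: n => [|n IHn]; first by rewrite cm1.
by rewrite /cpow iterS cmM cmU IHn mulSn.
Qed.

Lemma mdeg_cpow r n : mdeg (cpow r n) = n.
Proof.
by elim: n => [|n IHn]; rewrite ?mdeg1 // /cpow iterS mdegM mdegU IHn.
Qed.

(** In the recursion the term i = 0 contributes c X_m times the previous coefficient, of top degree.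
    For i > 0 a single variable comes with an earlier coefficient, so the degree drops. *)
Lemma lead_lamhat c m n : lead (cpow m n) (c ^+ n / n`!%:R) (lamhat c m n).
Proof.
have [G0 GS] := newton_lamhat c m.
elim/ltn_ind: n => -[|n] IHn.
  rewrite G0 expr0 fact0 divr1; exact: lead1.
have n1 : n.+1%:R != 0 :> rat by rewrite pnatr_eq0.
rewrite -[lamhat _ _ _](scalerK n1) scaler_nat GS.
have -> : c ^+ n.+1 / n.+1`!%:R = n.+1%:R^-1 * (c * (c ^+ n / n`!%:R)) :> rat.
  by rewrite exprS factS natrM invfM -!mulrA [RHS]mulrCA [_^-1 * (c ^+ n * _)]mulrCA.
apply: leadZ; rewrite big_ord_recl expr0 mul1r subn0.
have E : posint_mul m (posS 0%N) = m by apply: val_inj; rewrite /= muln1.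
rewrite E /lead addrAC; apply: deg_ltD.
  by have := leadM (leadZ c (@lead_X m)) (IHn n (ltnSn n)); rewrite mulr1.
rewrite mdeg_cpow; apply: deg_lt_sum => -[i /= lti] _.
have lt' : (n - bump 0 i < n.+1)%N by rewrite ltnS leq_subr.
have := lead_deg_lt (IHn _ lt'); rewrite mdeg_cpow.
have := lead_deg_lt (@lead_X (posint_mul m (posS (bump 0 i)))); rewrite mdegU.
move=> /(deg_ltZ ((-1) ^+ bump 0 i * c)); apply: deg_ltM.
by move: lti lt'; rewrite /bump leq0n; lia.
Qed.

Lemma lead_prod (I : Type) (s : seq I) (u : I -> {cmonom posint})
    (c : I -> rat) (F : I -> A) :
  (forall i, lead (u i) (c i) (F i)) ->
  lead (\big[mmul/mone]_(i <- s) u i) (\prod_(i <- s) c i) (\prod_(i <- s) F i).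
Proof.
move=> uF; elim: s => [|i s IHs]; first by rewrite !big_nil; apply: lead1.
by rewrite !big_cons; apply: leadM.
Qed.

Lemma cpow_decomp (k : {cmonom posint}) :
  \big[mmul/mone]_(m <- finsupp k) cpow m (k m) = k.
Proof.
apply/eqP/cmP => j; rewrite cmonom_big.
under eq_bigr do rewrite cpowE.
have [js|js] := boolP (j \in finsupp k).
  rewrite (bigD1_seq j) ?fset_uniq //= eqxx muln1 big1 ?addn0 // => i /negPf ->.
  by rewrite muln0.
have /eqP -> : k j == 0%N by rewrite cmE_eq0.
rewrite big_seq big1 // => i si; case: eqP => [ij|_]; last by rewrite muln0.
by rewrite -ij si in js.
Qed.

Definition Bprod (w : posint -> rat) (k : {cmonom posint}) : A :=
  \prod_(m <- finsupp k) lamhat (w m) m (k m).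

Definition Bprod_lc (w : posint -> rat) (k : {cmonom posint}) : rat :=
  \prod_(m <- finsupp k) (w m ^+ k m / (k m)`!%:R).

Lemma lead_Bprod w k : lead k (Bprod_lc w k) (Bprod w k).
Proof.
rewrite -[X in lead X]cpow_decomp; apply: lead_prod => m.
exact: lead_lamhat.
Qed.

Definition kfact (k : {cmonom posint}) : nat := (\prod_(m <- finsupp k) (k m)`!)%N.

Lemma Bprod_lc1 k : Bprod_lc (fun=> 1) k = (kfact k)%:R^-1.
Proof.
rewrite /Bprod_lc /kfact natr_prod -prodfV; apply: eq_bigr => m _.
by rewrite expr1n div1r.
Qed.

Lemma kfact_gt0 k : (0 < kfact k)%N.
Proof. by rewrite /kfact prodn_gt0 // => m; rewrite fact_gt0. Qed.

Lemma kfactM a k : kfact (mmul (ucm a) k) = ((k a).+1 * kfact k)%N.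
Proof.
have E (d : {fset posint}) (l : {cmonom posint}) : (finsupp l `<=` d)%fset ->
    kfact l = (\prod_(r <- d) (l r)`!)%N.
  move=> sub; rewrite /kfact (big_fset_incl _ sub) // => r _.
  by rewrite -cmE_eq0 => /eqP ->.
rewrite (E _ _ (fsubset_refl _)) mdomD (E _ k (fsubsetUr (finsupp (ucm a)) _)).
have ad : a \in (finsupp (ucm a) `|` finsupp k)%fset.
  by rewrite mdomU !inE eqxx.
rewrite !(bigD1_seq a ad) ?fset_uniq //= cmM cmU eqxx add1n factS mulnA.
congr (_ * _)%N; apply: eq_bigr => i; rewrite eq_sym => /negPf ia.
by rewrite cmM cmU ia.
Qed.

Lemma integral_Bprod k : integral (Bprod (fun=> 1) k).
Proof.
apply: subring_prod => [|m _ _]; first exact: integral_subring.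
exact: integral_lamhat.
Qed.

(** * Integral elements as combinations of products of the lambda_m (hat h_k) *)

Lemma co_XM r k f : co (mmul (ucm r) k) (X r * f) = co k f.
Proof.
have [s us ->] := coE f; rewrite mulr_sumr !linear_sum; apply: eq_bigr => l _.
by rewrite -scalerAr !linearZ /= -XmonU -XmonM !co_Xmon mmulI.
Qed.

Lemma co_XM0 r (k : {cmonom posint}) f : k r = 0%N -> co k (X r * f) = 0.
Proof.
move=> kr; have [s us ->] := coE f; rewrite mulr_sumr linear_sum big1 // => l _.
rewrite -scalerAr linearZ /= -XmonU -XmonM co_Xmon.
case: eqP => [E|_]; last by rewrite mulr0.
by move: kr; rewrite -E cmM cmUU.
Qed.

(** Expand the product of the X_r + y^r. As a > 0, at least one factor contributes its power of y,
    and the degree bound allows only one. So in these degrees [skew a] acts as the derivative in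
    X_a, and k_a + 1 is the exponent of X_a in l. *)
Lemma co_skew_Xmon (l k : {cmonom posint}) (a : posint) :
  (mdeg l <= (mdeg k).+1)%N ->
  co k (skew a (Xmon l)) = ((k a).+1 * (l == mmul (ucm a) k))%:R.
Proof.
elim/cmonom_ind: l k a => [|r l IHl] k a lk.
  rewrite Xmon1 -[1]scale1r /skew addvarA coefC (gtn_eqF (posint_gt0 a)) linear0.
  by rewrite eq_sym cmM_eq1 cm1_eq1 muln0.
have -> : skew a (Xmon (mmul (ucm r) l)) =
    X r * skew a (Xmon l) + (if (a < r)%N then 0 else skew (a - r)%N (Xmon l)).
  by rewrite /skew XmonM XmonU rmorphM addvar_X mulrDl coefD coefCM coefXnM.
rewrite mdegM mdegU add1n ltnS in lk; rewrite linearD /=.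
(* These are the terms where the factor X_r contributes y^r. If a = r the rest stays untouched; if a
   > r a second variable is lost and the degree is too small to reach k. *)
have -> : co k (if (a < r)%N then 0 else skew (a - r)%N (Xmon l)) =
    ((a == r) && (l == k))%:R.
  have [ar|ra] := ltnP a r.
    by rewrite linear0 -val_eqE /= ltn_eqF.
  have [->|nar] := eqVneq a r; first by rewrite subnn skew0 co_Xmon.
  have q0 : (0 < a - r)%N by rewrite subn_gt0 ltn_neqAle ra eq_sym nar.
  have := IHl k (PosInt q0); rewrite (leqW lk) => -> //=.
  case: eqP => [E|_]; last by rewrite muln0.
  by move: lk; rewrite E mdegM mdegU add1n ltnn.
have [kr|kr] := eqVneq (k r) 0%N.
  rewrite co_XM0 // add0r; have [->|ar] := eqVneq a r.
    by rewrite kr mul1n mmulI.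
  suff -> : (mmul (ucm r) l == mmul (ucm a) k) = false by rewrite muln0.
  apply/cmP => /(_ r); rewrite !cmM !cmU eqxx kr (negPf ar).
  by [].
set k1 := divcm k (ucm r); have kE : k = mmul (ucm r) k1 by apply: ucm_divK.
have lk1 : (mdeg l <= (mdeg k1).+1)%N by move: lk; rewrite kE mdegM mdegU add1n.
have CA : mmul (ucm a) (mmul (ucm r) k1) = mmul (ucm r) (mmul (ucm a) k1).
  by apply/eqP/cmP => i; rewrite !cmM addnCA.
rewrite kE co_XM IHl // CA !mmulI cmM cmU -natrD; congr (_%:R).
have [->|ar] := eqVneq a r; last by rewrite addn0.
by rewrite add1n /= mulSn addnC.
Qed.

Lemma co_skew d f (k : {cmonom posint}) (a : posint) :
  deg_lt d.+2 f -> (d <= mdeg k)%N ->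
  co k (skew a f) = (k a).+1%:R * co (mmul (ucm a) k) f.
Proof.
move=> df dk; have [s us fE] := coE f.
rewrite {1}fE [in RHS]fE skew_sum !linear_sum mulr_sumr; apply: eq_bigr => l _.
rewrite skewZ !linearZ /= co_Xmon.
have [dl|ld] := leqP d.+2 (mdeg l); first by rewrite df // !mul0r mulr0.
rewrite co_skew_Xmon; last by move: ld dk; lia.
by rewrite natrM mulrCA.
Qed.

Lemma deg_lt_skew d f (a : posint) : deg_lt d.+2 f -> deg_lt d.+1 (skew a f).
Proof.
move=> df k dk; rewrite (co_skew _ df (ltnW dk)) df ?mulr0 //.
by rewrite mdegM mdegU add1n.
Qed.

Lemma augm_co f : augm f = co mone f.
Proof.
have [s us fE] := coE f; rewrite fE rmorph_sum linear_sum; apply: eq_bigr => k _.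
rewrite augmZ linearZ /= co_Xmon; congr (_ * _).
elim/cmonom_ind: k => [|r k _]; first by rewrite Xmon1 rmorph1 eqxx.
by rewrite XmonM XmonU rmorphM augm_X mul0r cmM_eq1 cm1_eq1.
Qed.

(** Differentiating once for each variable of k, with multiplicity, turns the top coefficient into
    k! times itself as a constant term. These derivatives are [skew] operators, so the constant term
    is one of the integers in the definition of [integral]. *)
Lemma top_coef_int d f (k : {cmonom posint}) :
  integral f -> deg_lt d.+1 f -> mdeg k = d ->
  (kfact k)%:R * co k f \is a Num.int.
Proof.
elim: d f k => [|d IHd] f k Lf df dk.
  rewrite (mdeg_eq0I dk) -augm_co /kfact mdom1 big_seq_fset0 mul1r.
  exact: (Lf [::]).
have [a ak] : exists a, a \in finsupp k.
  by apply/fset0Pn; apply: contra_eqN dk => /eqP k0; rewrite mdegE k0 big_seq_fset0.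
rewrite -cmE_neq0 in ak; have kE := ucm_divK ak.
set k1 := divcm k _ in kE; rewrite kE mdegM mdegU add1n in dk; case: dk => dk.
have := IHd _ k1 (integral_skew a Lf) (deg_lt_skew _ df) dk.
by rewrite (co_skew _ df) ?dk // mulrA -natrM mulnC -kfactM -kE.
Qed.

Lemma deg_lt0 f : deg_lt 0%N f -> f = 0.
Proof.
move=> f0; have [s _ ->] := coE f.
by rewrite big1 // => k _; rewrite f0 // scale0r.
Qed.

Lemma deg_lt_bound f : exists d, deg_lt d f.
Proof.
have [s us fE] := coE f; exists (\max_(k <- s) (mdeg k).+1) => k lk.
apply: (co_notin us fE); apply: contraL lk => sk.
by rewrite -ltnNge; apply: (@leq_bigmax_seq _ _ _ (fun k => (mdeg k).+1)).
Qed.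

(** Induction on the degree. The product indexed by k has leading coefficient 1 / k!, so subtracting
    k! [co k f] times it, for all k of top degree, lowers the degree; these multipliers are integers
    and the difference stays integral. *)
Lemma integral_span f :
  integral f -> Zspan (fun x => exists k, x = Bprod (fun=> 1) k) f.
Proof.
have [d df] := deg_lt_bound f.
elim: d f df => [|d IHd] f df Lf; first by rewrite (deg_lt0 df); apply: Zspan0.
have [s us fE] := coE f; set B := fun x => _.
pose g := \sum_(k <- s | mdeg k == d) ((kfact k)%:R * co k f) *: Bprod (fun=> 1) k.
have ci k : mdeg k == d -> (kfact k)%:R * co k f \is a Num.int.
  by move=> /eqP; apply: top_coef_int.
have Bg : Zspan B g.
  apply: Zspan_sum => k _ dk; apply: ZspanZ (ci k dk) _.
  by apply: Zspan_in; exists k.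
have Lg : integral g.
  apply: (Zspan_subring integral_subring _ Bg) => x [k ->]; exact: integral_Bprod.
rewrite -(subrK g f); apply: ZspanD Bg; apply: IHd; last exact: integralB.
(* The first part is f without its top part; the second collects the lower-degree tails of the
   products. *)
have -> : f - g = (f - \sum_(k <- s | mdeg k == d) co k f *: Xmon k) -
   \sum_(k <- s | mdeg k == d) ((kfact k)%:R * co k f) *:
      (Bprod (fun=> 1) k - (kfact k)%:R^-1 *: Xmon k).
  rewrite -addrA -opprD -big_split; congr (_ - _); apply: eq_bigr => k _ /=.
  rewrite scalerBr scalerA mulrAC mulfV ?mul1r ?pnatr_eq0 -?lt0n ?kfact_gt0 //.
  by rewrite addrC subrK.
apply: deg_ltB; last first.
  apply: deg_lt_sum => k /eqP <-; apply: deg_ltZ; rewrite -Bprod_lc1; exact: lead_Bprod.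
move=> k dk; rewrite linearB /= co_sum //.
move: dk; rewrite leq_eqVlt eq_sym => /orP[/eqP dk|dk].
  rewrite dk eqxx andbT; case: ifP => [_|/negbT ks]; first by rewrite subrr.
  by rewrite (co_notin us fE ks) subr0.
by rewrite (gtn_eqF dk) andbF df // subr0.
Qed.

(** * Integral elements as integral polynomials in the hat h_k *)

Definition hatA n := lamhat 1 (posS 0%N) n.

Lemma posS0_mul r : posint_mul (posS 0%N) r = r.
Proof. by apply: val_inj; rewrite /= mul1n. Qed.

(** Newton's identities, solved for X_(n+1), express the variables as rational polynomials in the
    hat h_k. *)
Lemma hatA_gen (P : A -> Prop) : (forall c, P c%:A) ->
  (forall f g, P f -> P g -> P (f + g)) ->
  (forall f g, P f -> P g -> P (f * g)) ->
  (forall n, P (hatA n.+1)) -> forall f, P f.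
Proof.
move=> PC PD PM Pe; apply: poly_ind => // r; rewrite (posSE r).
have [e0 eS] := newton_lamhat 1 (posS 0%N).
have PZ c f : P f -> P (c *: f) by move=> Pf; rewrite -mulr_algl; apply: (PM).
have Pe' n : P (hatA n) by case: n => // ; rewrite /hatA e0 -[1]scale1r.
elim/ltn_ind: (_.-1) => n IHn.
have := eS n; rewrite big_ord_recr /= subnn e0 mulr1 mulr1 posS0_mul => E.
have -> : X (posS n) = (-1) ^+ n *: (hatA n.+1 *+ n.+1 - \sum_(i < n)
    ((-1) ^+ i * 1) *: X (posint_mul (posS 0%N) (posS i)) * hatA (n - i)).
  by rewrite E addrAC subrr add0r scalerA -expr2 sqrr_sign scale1r.
apply/PZ/(PD); first by rewrite -scaler_nat; apply: (PZ).
rewrite -scaleN1r; apply: (PZ); elim/big_ind: _ => [||i _].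
- by rewrite -[0](scale0r 1).
- exact: PD.
- by apply: (PM) => //; apply: (PZ); rewrite posS0_mul; apply: IHn.
Qed.

Definition hat_subst : {rmorphism A -> A} :=
  s2val (ev_ex (GRing.in_alg A) (fun r => hatA r)).

Lemma hat_subst_X r : hat_subst (X r) = hatA r.
Proof. by rewrite /hat_subst; case: ev_ex. Qed.

Lemma hat_substA c : hat_subst c%:A = c%:A.
Proof. by rewrite /hat_subst; case: ev_ex. Qed.

Lemma hat_substZ c f : hat_subst (c *: f) = c *: hat_subst f.
Proof. by rewrite -mulr_algl rmorphM hat_substA mulr_algl. Qed.

Lemma hat_subst_surj f : exists g, hat_subst g = f.
Proof.
elim/hatA_gen: f => [c|f g [f' <-] [g' <-]|f g [f' <-] [g' <-]|n].
- by exists c%:A; apply: hat_substA.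
- by exists (f' + g'); rewrite rmorphD.
- by exists (f' * g'); rewrite rmorphM.
- by exists (X (posS n)); rewrite hat_subst_X.
Qed.

(** The value 1 at r = 1 is a default. In [shift] it can only enlarge the index set, on which
    exponents are still read from k. *)
Definition pospred (r : posint) : posint := posS r.-2.

(* [Xmon k] stands here for prod_r (hat h_r)^(k r); as hat h_0 = 1, the variable of
   index 1 disappears. *)
Definition shift (k : {cmonom posint}) : {cmonom posint} :=
  [cmonom k (posS j) | j in [fset pospred r | r in finsupp k]%fset]%M.

Lemma shiftE k j : shift k j = k (posS j).
Proof.
rewrite /shift cmE fsfunE; case: ifP => // /negP js; apply/esym/eqP.
rewrite cmE_eq0; apply/negP => pj; apply: js; apply/imfsetP; exists (posS j) => //.
by rewrite /pospred /= -posSE.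
Qed.

Lemma shift1 : shift mone = mone.
Proof. by apply/eqP/cmP => j; rewrite shiftE !cm1. Qed.

Lemma shiftM k l : shift (mmul k l) = mmul (shift k) (shift l).
Proof. by apply/eqP/cmP => j; rewrite !(shiftE, cmM). Qed.

Lemma posint_case r : r = posS 0%N \/ r = posS (pospred r).
Proof.
rewrite (posSE r) /pospred /=; case: (r.-1) => [|n]; first by left.
by right.
Qed.

Lemma shift_posS0 : shift (ucm (posS 0%N)) = mone.
Proof.
apply/eqP/cmP => j; rewrite shiftE cm1 cmU -val_eqE /=.
by rewrite eqSS ltn_eqF ?posint_gt0.
Qed.

Lemma shift_posS (q : posint) : shift (ucm (posS q)) = ucm q.
Proof. by apply/eqP/cmP => j; rewrite shiftE !cmU -!val_eqE /= eqSS. Qed.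

Lemma mdeg_shift k : mdeg k = (k (posS 0%N) + mdeg (shift k))%N.
Proof.
elim/cmonom_ind: k => [|r k IHk]; first by rewrite shift1 !mdeg1 cm1.
rewrite shiftM !mdegM IHk cmM mdegU cmU addnA addnCA !addnA; congr (_ + _ + _)%N.
have [->|->] := posint_case r; first by rewrite eqxx shift_posS0 mdeg1.
by rewrite shift_posS mdegU -val_eqE.
Qed.

(** The exponent of index 1, forgotten by [shift], is recovered from the degree. *)
Lemma shift_inj k l : mdeg k = mdeg l -> shift k = shift l -> k = l.
Proof.
move=> dkl skl; apply/eqP/cmP => r; have [->|->] := posint_case r.
  by apply/eqP; rewrite -(eqn_add2r (mdeg (shift k))) -mdeg_shift skl -mdeg_shift dkl.
by rewrite -!shiftE skl.
Qed.

(** Each factor hat h_r becomes hat h_r + y hat h_(r-1), so the degree in y is at most the number of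
    factors and is reached by choosing y in each. *)
Lemma skew_hat_subst_Xmon k j : (mdeg k <= j)%N ->
  skew j (hat_subst (Xmon k)) = if j == mdeg k then hat_subst (Xmon (shift k)) else 0.
Proof.
elim/cmonom_ind: k j => [|r k IHk] j kj.
  rewrite shift1 Xmon1 rmorph1 mdeg1 -[1]scale1r /skew addvarA coefC.
  by rewrite scale1r.
rewrite shiftM !XmonM XmonU !rmorphM hat_subst_X mdegM mdegU add1n.
rewrite mdegM mdegU add1n in kj; case: j kj => // j; rewrite ltnS eqSS => kj.
have -> : hat_subst (Xmon (shift (ucm r))) = hatA r.-1.
  have [->|->] := posint_case r.
    by rewrite shift_posS0 Xmon1 rmorph1 /hatA lamhat0.
  by rewrite shift_posS XmonU hat_subst_X.
have -> : skew j.+1 (hatA r * hat_subst (Xmon k)) =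
    hatA r * skew j.+1 (hat_subst (Xmon k)) + hatA r.-1 * skew j (hat_subst (Xmon k)).
  rewrite /skew rmorphM /hatA addvar_lamhat -{1 2}(prednK (posint_gt0 r)).
  rewrite mulrDl coefD coefCM.
  by rewrite prednK ?posint_gt0 // -mulrA coefXnM /= subn1 /= coefCM.
rewrite !IHk ?leqW // gtn_eqF // mulr0 add0r.
by case: eqP => _; rewrite ?mulr0.
Qed.

Lemma integral_hat_subst_Xmon k : integral (hat_subst (Xmon k)).
Proof.
elim/cmonom_ind: k => [|r k IHk]; first by rewrite Xmon1 rmorph1; apply: integral1.
rewrite XmonM XmonU rmorphM hat_subst_X; apply: integralM IHk.
exact: integral_lamhat.
Qed.

(** Outer induction on the bound N for the indices of the variables, inner induction on the degree.
    The top part in y has its indices lowered by one, so the outer hypothesis makes its coefficients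
    integers; they are the top coefficients of g. Removing the top part of g leaves the inner
    case. *)
Lemma coef_int_of_integral N g : (forall k : {cmonom posint}, co k g != 0 ->
    forall r : posint, (N < r)%N -> k r = 0%N) ->
  integral (hat_subst g) -> forall k, co k g \is a Num.int.
Proof.
elim: N g => [|N IHN] g gN Lg.
  (* For N = 0 no variable occurs: g is a constant, equal to its constant term. *)
  have k1 k : co k g != 0 -> k = mone.
    move=> kg; apply/eqP/cmP => r; rewrite cm1; apply: gN => //.
    exact: posint_gt0.
  move=> k; have [->|kg] := eqVneq (co k g) 0; first exact: rpred0.
  have gE : g = (co mone g)%:A.
    have [s us E] := coE g; rewrite E linear_sum [RHS]scaler_suml.
    apply: eq_bigr => l _; rewrite linearZ /= co_Xmon.
    have [->|/k1 ->] := eqVneq (co l g) 0; first by rewrite mul0r !scale0r.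
    by rewrite eqxx mulr1 Xmon1.
  by rewrite (k1 k kg); have := Lg [::]; rewrite gE hat_substA /= augmA -gE.
have [n] := deg_lt_bound g; elim: n g gN Lg => [|n IHn] g gN Lg dg.
  by rewrite (deg_lt0 dg) => k; rewrite linear0 rpred0.
have [s us gE] := coE g.
pose g1 := \sum_(k <- s | mdeg k == n) co k g *: Xmon (shift k).
pose top := \sum_(k <- s | mdeg k == n) co k g *: Xmon k.
have Lg1 : integral (hat_subst g1).
  (* Monomials of degree below n have no term in y^n, so [skew n] sees only the top part. *)
  suff -> : hat_subst g1 = skew n (hat_subst g) by apply: integral_skew.
  rewrite [in RHS]gE /g1 !rmorph_sum skew_sum big_mkcond; apply: eq_bigr => k _.
  have [nk|kn] := ltnP n (mdeg k).
    by rewrite (gtn_eqF nk) hat_substZ skewZ (dg k nk) scale0r.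
  rewrite !hat_substZ skewZ skew_hat_subst_Xmon // eq_sym.
  by case: ifP; rewrite ?scaler0.
have co_sh k : k \in s -> mdeg k = n -> co (shift k) g1 = co k g.
  move=> ks kn; rewrite /g1 linear_sum big_mkcond (bigD1_seq k) //= kn eqxx.
  rewrite linearZ /= co_Xmon eqxx mulr1 big1 ?addr0 // => l lk.
  case: eqP => // ln; rewrite linearZ /= co_Xmon.
  case: eqP => [E|_]; last by rewrite mulr0.
  by case/eqP: lk; apply: shift_inj => //; rewrite ln.
have g1N (l : {cmonom posint}) : co l g1 != 0 ->
    forall r : posint, (N < r)%N -> l r = 0%N.
  move=> lg1 r Nr; apply/eqP/negPn/negP => lr; case/negP: lg1.
  rewrite /g1 linear_sum big1 // => k _; rewrite linearZ /= co_Xmon.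
  case: eqP => [kl|_]; last by rewrite mulr0.
  have [->|kg] := eqVneq (co k g) 0; first by rewrite mul0r.
  by case/eqP: lr; rewrite -kl shiftE; apply: gN.
have top_int k : k \in s -> mdeg k = n -> co k g \is a Num.int.
  by move=> ks kn; rewrite -co_sh //; apply: IHN.
have co_top k : co k top = if (k \in s) && (mdeg k == n) then co k g else 0.
  exact: co_sum.
have Ltop : integral (hat_subst top).
  rewrite /top rmorph_sum; apply: (subring_sum integral_subring) => k ks /eqP kn.
  rewrite hat_substZ; apply: (subringZ integral_subring); first exact: top_int.
  exact: integral_hat_subst_Xmon.
have IH : forall k, co k (g - top) \is a Num.int.
  apply: IHn => [k||k nk].
  - rewrite linearB /= co_top; case: ifP => _; first by rewrite subrr eqxx.
    by rewrite subr0; apply: gN.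
  - by rewrite rmorphB; apply: integralB.
  - rewrite linearB /= co_top; case: eqP => [kn|kn].
      rewrite andbT; case: ifP => [_|/negbT ks]; first exact: subrr.
      by rewrite (co_notin us gE ks) subr0.
    by rewrite andbF subr0; apply: dg; move: nk kn; lia.
move=> k; rewrite -(subrK top g) linearD rpredD //= co_top.
by case: ifP => [/andP[ks /eqP kn]|_]; [apply: top_int|apply: rpred0].
Qed.

Lemma supp_bound (s : seq {cmonom posint}) :
  exists N, forall k, k \in s -> forall r : posint, (N < r)%N -> k r = 0%N.
Proof.
exists (\max_(k <- s) \max_(r <- finsupp k) r) => k ks r; apply: contraTeq.
rewrite cmE_neq0 -leqNgt => kr.
have h1 : (r <= \max_(i <- finsupp k) i)%N.
  exact: (@leq_bigmax_seq _ _ xpredT (fun i : posint => posint_val i)).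
apply: leq_trans h1 _.
exact: (@leq_bigmax_seq _ _ xpredT
  (fun k' : {cmonom posint} => \max_(i <- finsupp k') posint_val i)).
Qed.

Lemma integral_gen f : integral f -> subring_gen (fun x => exists n, x = hatA n.+1) f.
Proof.
move=> Lf; have [g gf] := hat_subst_surj f; have [s us gE] := coE g.
have [N sN] := supp_bound s.
set V := subring_gen _; have sV : is_subring V by apply: subring_gen_subring.
have ci : forall k, co k g \is a Num.int.
  apply: (@coef_int_of_integral N); last by rewrite gf.
  move=> k kg; apply: sN; apply: contraR kg => ks.
  by rewrite (co_notin us gE ks).
rewrite -gf gE rmorph_sum; apply: (subring_sum sV) => k _ _.
rewrite hat_substZ; apply: subringZ => //.
elim/cmonom_ind: k => [|r k IHk]; first by rewrite Xmon1 rmorph1; case: sV.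
rewrite XmonM XmonU rmorphM hat_subst_X; case: (sV) => _ _; apply=> //.
by apply: subring_gen_in; exists r.-1; rewrite prednK ?posint_gt0.
Qed.

(** * The mixed form and its basis *)

Definition mix_genA (x : A) : Prop := exists2 k : nat, (0 < k)%N &
  x = hgenA (fun=> 1) k \/ x = hgenA (fun r => if odd r then 0 else 1) k.

Definition bprime (k : {fsfun posint -> nat with 0%N}) : A :=
  (\prod_(m <- finsupp k | odd m) lam m (hgenA (fun=> 1) (k m))) *
  (\prod_(m <- finsupp k | ~~ odd m) lam m (hgenA (fun=> 1 / 2) (k m))).

Definition Bprime x := exists k, x = bprime k.

Definition mixw (m : posint) : rat := if odd m then 1 else 1 / 2.

Lemma bprimeE k : bprime k = Bprod mixw (CMonom k).
Proof.
rewrite /bprime /Bprod [RHS](bigID (fun m : posint => odd m)) /=; congr (_ * _).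
  by apply: eq_bigr => m om; rewrite /mixw om.
by apply: eq_bigr => m /negPf om; rewrite /mixw om.
Qed.

Lemma mixw_neq0 m : mixw m != 0.
Proof. by rewrite /mixw; case: odd. Qed.

Lemma Bprod_lc_neq0 w k : (forall m, w m != 0) -> Bprod_lc w k != 0.
Proof.
move=> w0; rewrite /Bprod_lc; elim/big_ind: _ => // [x y|m _].
  exact: mulf_neq0.
by rewrite mulf_neq0 ?expf_neq0 // invr_eq0 pnatr_eq0 -lt0n fact_gt0.
Qed.

(** Descending induction on the degree: once the coefficients of higher degree vanish, the monomial
    k receives a contribution from [b k] alone, with nonzero leading coefficient. *)
Lemma Zfree_lead (b : {cmonom posint} -> A) (c : {cmonom posint} -> rat) :
  (forall k, c k != 0) -> (forall k, lead k (c k) (b k)) ->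
  Zfree (fun x => exists k, x = b k).
Proof.
move=> c0 lb s d us Bs E.
have [t st] : exists t, s = [seq b k | k <- t].
  elim: s Bs {us E} => [|x s IHs] Bs; first by exists [::].
  have [|t ->] := IHs; first by move=> y ys; apply: Bs; rewrite inE ys orbT.
  have [k ->] := Bs x (mem_head _ _).
  by exists (k :: t).
have ut : uniq t by move: us; rewrite st => /map_uniq.
have [D tD] : exists D, forall k, k \in t -> (mdeg k < D)%N.
  exists (\max_(k <- t) mdeg k).+1 => k kt; rewrite ltnS.
  exact: (@leq_bigmax_seq _ _ xpredT (fun k : {cmonom posint} => mdeg k)).
have E' : \sum_(k <- t) (d (b k))%:~R *: b k = 0.
  rewrite st big_map in E; rewrite -[RHS]E.
  by apply: eq_bigr => k _; rewrite scaler_int.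
suff H n k : k \in t -> (D <= mdeg k + n)%N -> d (b k) = 0.
  move=> x; rewrite st => /mapP[k kt ->]; apply: (H D k kt).
  exact: leq_addl.
elim: n k => [|n IHn] k kt.
  by rewrite addn0 leqNgt tD.
rewrite addnS => Dn.
have := congr1 (co k) E'; rewrite linear0 linear_sum (bigD1_seq k) //=.
rewrite linearZ /= (lead_co (lb k) (leqnn _)) eqxx mulr1 big_seq_cond big1 ?addr0.
  by move/eqP; rewrite mulf_eq0 (negPf (c0 k)) orbF intr_eq0 => /eqP.
move=> l /andP[lt lk]; rewrite linearZ /=.
have [kl|lk'] := ltnP (mdeg k) (mdeg l).
  by rewrite IHn ?mul0r // (leq_trans Dn) // -addSn leq_add2r.
by rewrite (lead_co (lb l) lk') (negPf lk) !mulr0.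
Qed.

Lemma Zfree_Bprime : Zfree Bprime.
Proof.
have H := @Zfree_lead (Bprod mixw) (Bprod_lc mixw)
  (fun k => Bprod_lc_neq0 k mixw_neq0) (@lead_Bprod mixw).
move=> s c us Bs E; apply: H us _ E => x /Bs[k ->].
by exists (CMonom k); rewrite bprimeE.
Qed.

Definition mixA := subring_gen mix_genA.

Lemma mixA_subring : is_subring mixA.
Proof. exact: subring_gen_subring. Qed.

Lemma integral_mixA f : integral f -> mixA f.
Proof.
move/integral_gen; apply: subring_gen_min mixA_subring _ _ => x [n ->].
by apply: subring_gen_in; exists n.+1 => //; left; rewrite hgenAE.
Qed.

(* h_r |-> h_(2r) / 2. *)
Definition dbl (f : A) : A := lam (posS 1%N) (dilate (1 / 2) f).

Lemma dblB f g : dbl (f - g) = dbl f - dbl g.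
Proof. by rewrite /dbl !rmorphB. Qed.

Lemma dblM f g : dbl (f * g) = dbl f * dbl g.
Proof. by rewrite /dbl !rmorphM. Qed.

Lemma dbl1 : dbl 1 = 1.
Proof. by rewrite /dbl !rmorph1. Qed.

Lemma dbl_lamhat m n :
  dbl (lamhat 1 m n) = lamhat (1 / 2) (posint_mul (posS 1%N) m) n.
Proof. by rewrite /dbl dilate_lamhat lam_lamhat. Qed.

Definition evenpart x := exists2 g, integral g & x = dbl g.

Lemma evenpart_subring : is_subring evenpart.
Proof.
split=> [|x y [f Lf ->] [g Lg ->]|x y [f Lf ->] [g Lg ->]].
- by exists 1; [exact: integral1|rewrite dbl1].
- by exists (f - g); [exact: integralB|rewrite dblB].
- by exists (f * g); [exact: integralM|rewrite dblM].
Qed.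

Lemma even_posint (m : posint) : ~~ odd m -> m = posint_mul (posS 1%N) (posS (m./2).-1).
Proof.
move=> em; apply: val_inj; rewrite /= mul2n.
have mE := odd_double_half m; rewrite (negPf em) add0n in mE.
by rewrite prednK ?mE // -double_gt0 mE posint_gt0.
Qed.

Lemma evenpart_lamhat_half (m : posint) n : ~~ odd m -> evenpart (lamhat (1 / 2) m n).
Proof.
move/even_posint ->; rewrite -dbl_lamhat.
by exists (lamhat 1 (posS m./2.-1) n) => //; apply: integral_lamhat.
Qed.

Lemma evenpart_lamhat (m : posint) n : ~~ odd m -> evenpart (lamhat 1 m n).
Proof.
move=> em; rewrite lamhat_conv; apply: (subring_sum evenpart_subring) => i _ _.
by case: evenpart_subring => _ _; apply; apply: evenpart_lamhat_half.
Qed.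

(** The integral elements are generated by the hat h_n, and [dbl] sends hat h_n to lambda_2 (check
    h_n), which is bar h_(2n) up to sign. *)
Lemma evenpart_mixA f : evenpart f -> mixA f.
Proof.
have [A1 AB AM] := mixA_subring.
case=> g /integral_gen Lg ->.
apply: (subring_gen_min (P := fun f => mixA (dbl f)) _ _ Lg) => [|x [n ->]].
  split=> [|x y|x y]; first by rewrite dbl1.
    by rewrite dblB; apply: AB.
  by rewrite dblM; apply: AM.
rewrite /hatA dbl_lamhat.
have -> : posint_mul (posS 1%N) (posS 0%N) = posS 1%N by apply: val_inj.
have := barhE n.+1.*2; rewrite odd_double doubleK [RHS]/= => E.
have -> : lamhat (1 / 2) (posS 1%N) n.+1 =
    (-1) ^+ n.+1 *: hgenA (fun r => if odd r then 0 else 1) n.+1.*2.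
  rewrite E -[RHS]mulr_algl mulrA.
  suff -> : ((-1) ^+ n.+1)%:A * (-1) ^+ n.+1 = 1 :> A by rewrite [RHS]mul1r.
  rewrite -(signr_odd rat) -[X in _ * X](signr_odd A).
  by case: odd; rewrite ?(expr0, expr1, scaleN1r, scale1r) ?mulrNN mulr1.
apply: subringZ mixA_subring _ _; first by rewrite rpredX // rpredN rpred1.
by apply: subring_gen_in; exists n.+1.*2 => //; right.
Qed.

Lemma Bprime_mixA x : Bprime x -> mixA x.
Proof.
case=> k ->; rewrite bprimeE; apply: (subring_prod mixA_subring) => m _ _.
rewrite /mixw; case: ifP => om; first by apply/integral_mixA/integral_lamhat.
by apply/evenpart_mixA/evenpart_lamhat_half; rewrite om.
Qed.

Lemma prod_support (F : posint -> nat -> A) (Q : pred posint)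
    (d : {fset posint}) (k : {cmonom posint}) :
  (forall m, F m 0%N = 1) -> (forall r, Q r -> k r != 0%N -> r \in d) ->
  \prod_(m <- d | Q m) F m (k m) = \prod_(m <- finsupp k | Q m) F m (k m).
Proof.
move=> F0 kd.
have -> : \prod_(m <- d | Q m) F m (k m) =
          \prod_(m <- d | Q m && (k m != 0%N)) F m (k m).
  rewrite big_mkcondr; apply: eq_bigr => m _.
  by case: eqP => // ->; rewrite F0.
rewrite -big_filter -[RHS]big_filter; apply: perm_big; apply: uniq_perm.
- by rewrite filter_uniq ?fset_uniq.
- by rewrite filter_uniq ?fset_uniq.
move=> r; rewrite !mem_filter -andbA -cmE_neq0; case Qr: (Q r) => //=.
case kr: (k r != 0%N) => //=.
by rewrite kd.
Qed.

(* Exponents are indexed by m in the first factor and by m / 2 in the second. *)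
Lemma merge_parts (k l : {cmonom posint}) :
  exists K, bprime K = (\prod_(m <- finsupp k | odd m) lamhat 1 m (k m)) *
    (\prod_(m <- finsupp l) lamhat (1 / 2) (posint_mul (posS 1%N) m) (l m)).
Proof.
pose d2 := [fset posint_mul (posS 1%N) m | m in finsupp l]%fset.
pose half (r : posint) := posS (r./2).-1.
have half_dbl m : half (posint_mul (posS 1%N) m) = m.
  by apply: val_inj; rewrite /= mul2n doubleK prednK ?posint_gt0.
(* The exponents of k at even indices are discarded, as only its odd factors occur in the
   product. *)
pose K : {cmonom posint} := [cmonom (if odd (posint_val r) then k r else l (half r))
  | r in (finsupp k `|` d2)%fset]%M.
have oddK (r : posint) : odd r -> K r = k r.
  move=> ro; rewrite /K cmE fsfunE ro inE; case: ifP => // /negbT.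
  by rewrite negb_or -cmE_eq0 => /andP[/eqP].
have evenK (r : posint) : ~~ odd r -> K r = l (half r).
  move=> re; rewrite /K cmE fsfunE (negPf re) inE; case: ifP => // /negbT.
  rewrite negb_or => /andP[_ rd]; apply/esym/eqP; rewrite cmE_eq0.
  apply: contra rd => hl; apply/imfsetP; exists (half r) => //.
  exact: even_posint.
exists (cmonom_val K); rewrite /bprime; congr (_ * _).
  have F0 m : lamhat 1 m 0%N = 1 by apply: lamhat0.
  rewrite -(@prod_support _ (fun r : posint => odd r) (finsupp k) K F0).
    by apply: eq_bigr => m om; rewrite oddK.
  by move=> r ro; rewrite oddK // cmE_neq0.
have F0 m : lamhat (1 / 2) m 0%N = 1 by apply: lamhat0.
rewrite -(@prod_support _ (fun r : posint => ~~ odd r) d2 K F0); last first.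
  move=> r re; rewrite evenK // cmE_neq0 => hl.
  by apply/imfsetP; exists (half r) => //; apply: even_posint.
rewrite big_mkcond big_imfset /=; last first.
  by move=> m n _ _ /(congr1 half); rewrite !half_dbl.
apply: eq_bigr => m _; rewrite mul2n odd_double /=.
by rewrite evenK ?half_dbl //= mul2n odd_double.
Qed.

Lemma evenpart_span f : evenpart f -> Zspan (fun x => exists l : {cmonom posint},
  x = \prod_(m <- finsupp l) lamhat (1 / 2) (posint_mul (posS 1%N) m) (l m)) f.
Proof.
case=> g /integral_span; set B := fun x => _ => Lg ->.
apply: (Zspan_min (P := fun x => Zspan _ (dbl x)) _ _ _ Lg) => [|u v|u [k ->]].
- by rewrite -(subrr 0) dblB subrr; apply: Zspan0.
- by rewrite dblB; apply: ZspanB.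
apply: Zspan_in; exists k; rewrite /Bprod /dbl !rmorph_prod.
by apply: eq_bigr => m _; rewrite -dbl_lamhat.
Qed.

(** Expand f in the first basis, move the factors with m even into g, expand the result in the basis
    of [evenpart], and merge the two exponent families. *)
Lemma integral_evenpart_span f g : integral f -> evenpart g -> Zspan Bprime (f * g).
Proof.
move/integral_span => Lf Eg.
apply: (Zspan_min (P := fun x => Zspan _ (x * g)) _ _ _ Lf) => [|x y xg yg|x [k ->]].
- by rewrite mul0r; apply: Zspan0.
- by rewrite mulrBl; apply: ZspanB.
rewrite /Bprod (bigID (fun m : posint => odd m)) /= -mulrA.
set u := _ * g; have : evenpart u.
  case: (evenpart_subring) => _ _; apply=> //.
  by apply: (subring_prod evenpart_subring) => m _; apply: evenpart_lamhat.
move/evenpart_span => Eu; set v := \prod_(_ <- _ | _) _.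
apply: (Zspan_min (P := fun x => Zspan _ (v * x)) _ _ _ Eu) => [|y z yg zg|y [l ->]].
- by rewrite mulr0; apply: Zspan0.
- by rewrite mulrBr; apply: ZspanB.
by have [K KE] := merge_parts k l; rewrite /v -KE; apply: Zspan_in; exists K.
Qed.

Definition mixprod x := exists f g, [/\ integral f, evenpart g & x = f * g].

(** The span of the products of an integral element and an element of [evenpart] is closed under
    multiplication by commutativity and contains the generators, hence all of [mixA]. *)
Lemma mixA_span x : mixA x <-> Zspan Bprime x.
Proof.
split; last by move=> Bx; apply: (Zspan_subring mixA_subring Bprime_mixA Bx).
move=> Ax; apply: (@Zspan_mono _ mixprod) => [_ [f [g [Lf Eg ->]]]|].
  exact: integral_evenpart_span.
have [E1 _ EM] := evenpart_subring.
apply: (subring_gen_min (P := Zspan mixprod) _ _ Ax) => [|y [k k0 yk]].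
  split; first (apply: Zspan_in; exists 1, 1; split;
    [exact: integral1|exact: E1|by rewrite mulr1]).
    exact: ZspanB.
  move=> y z Sy Sz; apply: (Zspan_min (P := fun x => Zspan _ (x * z)) _ _ _ Sy)
    => [|u v uz vz|u [f [g [Lf Eg ->]]]].
  - by rewrite mul0r; apply: Zspan0.
  - by rewrite mulrBl; apply: ZspanB.
  apply: (Zspan_min (P := fun x => Zspan _ (f * g * x)) _ _ _ Sz)
    => [|u' v uz vz|u' [f' [g' [Lf' Eg' ->]]]].
  - by rewrite mulr0; apply: Zspan0.
  - by rewrite mulrBr; apply: ZspanB.
  apply: Zspan_in; exists (f * f'), (g * g'); rewrite mulrACA; split=> //.
    exact: integralM.
  exact: EM.
case: yk => ->.
  rewrite hgenAE; apply: Zspan_in; exists (lamhat 1 (posS 0%N) k), 1.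
  by split; [exact: integral_lamhat|exact: E1|rewrite mulr1].
rewrite barhE; case: odd; first exact: Zspan0.
(* The sign serves as the integral factor. *)
apply: Zspan_in; exists ((-1) ^+ k./2), (lamhat (1 / 2) (posS 1%N) k./2).
split=> //; last exact: evenpart_lamhat_half.
elim: (k./2) => [|n IHn]; first exact: integral1.
rewrite exprS; apply: integralM IHn; rewrite -[-1]sub0r; apply: integralB integral1.
exact: subring0 integral_subring.
Qed.

(** Having a positive multiple in [mixA] is stable under sums and products, and holds for rational
    constants and for the hat h_k, which generate the algebra. This gives the surjectivity of the
    evaluation map. *)
Lemma mixA_full x : exists n, mixA (x *+ n.+1).
Proof.
have sA := mixA_subring; have [A1 _ AM] := sA.
have AMn y n : mixA y -> mixA (y *+ n).
  by move=> Ay; rewrite -scaler_nat; apply: subringZ => //; apply: rpred_nat.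
have AD y z : mixA y -> mixA z -> mixA (y + z).
  by move=> Ay Az; have := @subring_sum _ mixA _ [:: true; false] xpredT
    (fun b => if b then y else z) sA; rewrite big_cons big_seq1; apply => -[].
elim/hatA_gen: x => [c|f g [n fn] [m gm]|f g [n fn] [m gm]|n].
- exists (`|denq c|%N.-1); rewrite prednK ?absz_gt0 ?denq_neq0 //.
  rewrite -scaler_nat scalerA; apply: subringZ => //.
  by rewrite pmulrn absz_denq mulrC -numqE rpred_int.
- exists (n.+1 * m.+1).-1; rewrite prednK // mulrnDl; apply: AD.
    by rewrite mulrnA; apply: AMn.
  by rewrite mulnC mulrnA; apply: AMn.
- exists (n.+1 * m.+1).-1; rewrite prednK // mulrnA -mulrnAl -mulrnAr.
  exact: AM.
- exists 0%N; rewrite mulr1n; apply: subring_gen_in; exists n.+1 => //.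
  by left; rewrite hgenAE.
Qed.

End PolynomialAlgebra.

(** * The concrete algebra as an instance *)

Section Evaluation.
Variables (S : comNzRingType) (f : {rmorphism rat -> S}) (c : posint -> S).

Definition ev_monom (k : {cmonom posint}) : S :=
  \prod_(r <- finsupp k) c r ^+ k r.

Fact ev_monom_morphism : mmorphism ev_monom.
Proof.
have E (d : {fset posint}) (k : {cmonom posint}) : (finsupp k `<=` d)%fset ->
    ev_monom k = \prod_(r <- d) c r ^+ k r.
  move=> sub; rewrite /ev_monom (big_fset_incl _ sub) // => r _.
  by rewrite -cmE_eq0 => /eqP ->; rewrite expr0.
split=> [k k'|]; last by rewrite /ev_monom mdom1 big_seq_fset0.
rewrite (E _ _ (fsubset_refl _)) mdomD (E _ k (fsubsetUl _ (finsupp k'))).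
rewrite (E _ k' (fsubsetUr (finsupp k) _)) -big_split /=.
by apply: eq_bigr => r _; rewrite cmM exprD.
Qed.
HB.instance Definition _ :=
  isMultiplicative.Build _ _ ev_monom ev_monom_morphism.

Lemma evaluation : {e : {rmorphism Qh -> S} |
  (forall x, e x%:A = f x) & (forall r, e (h r) = c r)}.
Proof.
exists (mmap f ev_monom : {rmorphism Qh -> S}) => [x|r] /=.
  by rewrite -mul_malgC mulr1; exact: mmapC.
rewrite mmapU /= rmorph1 mul1r.
by rewrite /ev_monom mdomU big_seq_fset1 cmUU expr1.
Qed.

End Evaluation.

Lemma malgUM (K : monomType) (R : nzRingType) (k l : K) :
  << mmul k l >> = << k >> * << l >> :> {malg R[K]}.
Proof. by rewrite [RHS]malgME !msuppU1 !big_seq_fset1 !mcoeffUU mulr1. Qed.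

Lemma malgUZ (K : choiceType) (R : nzRingType) (c : R) (k : K) :
  << c *g k >> = c *: << k >> :> {malg R[K]}.
Proof. by apply/malgP => l; rewrite mcoeffZ !mcoeffU mulrnAr mulr1. Qed.

Definition hQ : posint -> (Qh : comAlgType rat) := h.
Definition coefQ (k : {cmonom posint}) : {scalar (Qh : comAlgType rat)} :=
  mcoeff k.
Definition lambdaQ (m : posint) :
  {rmorphism (Qh : comAlgType rat) -> (Qh : comAlgType rat)} := lambda m.

Lemma Xmon_h (k : {cmonom posint}) : Xmon hQ k = << k >>.
Proof.
elim/cmonom_ind: k => [|r k IHk]; first exact: Xmon1.
by rewrite XmonM XmonU IHk malgUM.
Qed.

Lemma co_Xmon_h (k l : {cmonom posint}) : coefQ l (Xmon hQ k) = (k == l)%:R.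
Proof. by rewrite Xmon_h /= mcoeffU. Qed.

Lemma coE_h (f : Qh) : exists2 s : seq {cmonom posint}, uniq s &
  f = \sum_(k <- s) coefQ k f *: Xmon hQ k.
Proof.
exists (msupp f); first exact: fset_uniq.
rewrite {1}[f]monalgE; apply: eq_bigr => k _.
by rewrite malgUZ Xmon_h.
Qed.

Lemma lambdaQZ m c f : lambdaQ m (c *: f) = c *: lambdaQ m f.
Proof. exact: lambda_is_scalable. Qed.

Lemma lambdaQ_h m r : lambdaQ m (hQ r) = hQ (posint_mul m r).
Proof. exact: lambda_h. Qed.

Theorem theorem16 :
  (forall x : Qh, Zmix x <-> Z'lambda x) /\
  is_integral_form Zmix /\
  is_Zbasis B'lambda Zmix.
Proof.
have span x : Zmix x <-> Z'lambda x.
  exact: (mixA_span co_Xmon_h coE_h evaluation lambdaQZ lambdaQ_h).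
have basis : is_Zbasis B'lambda Zmix.
  split=> //; exact: (Zfree_Bprime co_Xmon_h coE_h lambdaQZ lambdaQ_h).
have sub : is_subring Zmix by apply: subring_gen_subring.
split=> //; split=> //; split=> //; first by exists B'lambda.
apply: tensor_eval_bij sub _ => x.
exact: (mixA_full coE_h lambdaQZ lambdaQ_h).
Qed.
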